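(* Let $P_n(x)=\sum_{k=0}^{2n}s(P_n,k)x^k$ be the sextet polynomial of the pyrene chain $P_n$. Then the numbers $s(P_n,k)$ are asymptotically normal, both by a central limit theorem and by a local limit theorem on $\mathbb{R}$, with mean $\mu_n=n$ and variance $\sigma_n^2\sim\frac{\sqrt{2}}{4}n$ as $n\to\infty$.
   Context: Let $a(n,k)$ be a double-indexed sequence of nonnegative numbers, let $p(n,k)=a(n,k)/\sum_j a(n,j)$ be the normalized probabilities, and let $\mu_n$ and $\sigma_n^2$ be the mean and variance of the distribution $k\mapsto p(n,k)$. The sequence $a(n,k)$ is asymptotically normal by a central limit theorem if $$\lim_{n\to\infty}\sup_{x\in\mathbb{R}}\left|\sum_{k\le\mu_n+x\sigma_n}p(n,k)-\frac{1}{\sqrt{2\pi}}\int_{-\infty}^xe^{-t^2/2}\,dt\right|=0,$$ and asymptotically normal by a local limit theorem on $\mathbb{R}$ if $$\lim_{n\to\infty}\sup_{x\in\mathbb{R}}\left|\sigma_n\,p(n,\lfloor\mu_n+x\sigma_n\rfloor)-\frac{1}{\sqrt{2\pi}}e^{-x^2/2}\right|=0.$$ Here $a(n,k)=s(P_n,k)$, taken to be $0$ for $k<0$ or $k>2n$. A hexagonal system is a finite connected plane graph without cut vertices in which every interior face is bounded by a regular hexagon of side length $1$; its hexagons are its interior faces. Let $H$ be a hexagonal system with at least one perfect matching (Kekulé structure). A Clar cover of $H$ is a spanning subgraph of $H$ each connected component of which is either a hexagon or an edge. A resonant pattern of $H$ is the set of hexagons of a Clar cover of $H$. The Clar number $C(H)$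 is the maximum number of hexagons in a resonant pattern. The sextet polynomial of $H$ is $\sigma(H,x)=\sum_{k=0}^{C(H)}s(H,k)x^k$, where $s(H,k)$ is the number of resonant patterns of $H$ with exactly $k$ hexagons and $s(H,0)=1$. The pyrene chain $P_n$ ($n\ge 1$) is the hexagonal system with $4n$ hexagons consisting of a straight horizontal row of $2n$ hexagons $h_1,\dots,h_{2n}$ of the hexagonal lattice (consecutive ones sharing a vertical edge) together with, for each $i=1,\dots,n$, the lattice hexagon above the row adjacent to both $h_{2i-1}$ and $h_{2i}$ and the lattice hexagon below the row adjacent to both $h_{2i-1}$ and $h_{2i}$. Its sextet polynomial is denoted $P_n(x)=\sigma(P_n,x)$, and $P_0(x)=1$ by convention. These polynomials are determined by $P_0(x)=1$, $P_1(x)=x^2+4x+1$ and the known recurrence $P_n(x)=(x^2+4x+1)P_{n-1}(x)-x^2P_{n-2}(x)$ for $n\ge 2$. *)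

(* Defs.v *)
From HB Require Import structures.
From mathcomp Require Import all_boot all_order all_algebra finmap.
From mathcomp Require Import all_classical all_reals all_analysis.
Set Implicit Arguments.
Unset Strict Implicit.
Unset Printing Implicit Defensive.
Import Order.TTheory GRing.Theory Num.Theory.
Import numFieldNormedType.Exports.
Local Open Scope classical_set_scope.
Local Open Scope ring_scope.

(* The hexagonal lattice of side length 1, with two vertical edges per hexagon:
   the pair (x, y) of integers stands for the point (x * sqrt 3 / 2, y / 2) of
   the plane.  The hexagon centred at (x, y) then has its vertices at
   (x, y +- 2) and (x +- 1, y +- 1), the hexagon to its right is centred at
   (x + 2, y), and the two hexagons above it at (x +- 1, y + 3). *)
Definition lattice_point := (int * int)%type.

Definition hex_corners (c : lattice_point) : seq lattice_point :=
  [:: (c.1, c.2 + 2); (c.1 + 1, c.2 + 1); (c.1 + 1, c.2 - 1);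
      (c.1, c.2 - 2); (c.1 - 1, c.2 - 1); (c.1 - 1, c.2 + 1)].

Definition hex_verts (c : lattice_point) : {fset lattice_point} :=
  [fset v in hex_corners c]%fset.

Definition hex_edges (c : lattice_point) : {fset {fset lattice_point}} :=
  [fset [fset v; next (hex_corners c) v] | v in hex_verts c]%fset.

(* A hexagonal system is represented by the set H of the centres of its
   hexagons (its interior faces).  Having no cut vertex, it is the union of the
   boundaries of these hexagons; an edge is the set of its two ends. *)
Definition hs_verts (H : {fset lattice_point}) : {fset lattice_point} :=
  (\bigcup_(c <- H) hex_verts c)%fset.

Definition hs_edges (H : {fset lattice_point}) : {fset {fset lattice_point}} :=
  (\bigcup_(c <- H) hex_edges c)%fset.

(* (A, D) is a connected component of the graph with vertex set V and edge set
   F: A is its set of vertices and D its set of edges. *)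
Definition connected_by (F : {fset {fset lattice_point}}) (u v : lattice_point) : Prop :=
  exists2 p : seq lattice_point,
    path (fun x y => [fset x; y]%fset \in F) u p & last u p = v.

Definition component (V : {fset lattice_point}) (F : {fset {fset lattice_point}})
    (A : {fset lattice_point}) (D : {fset {fset lattice_point}}) : Prop :=
  [/\ exists2 u, u \in V & forall v, v \in A <-> connected_by F u v
    & D = [fset e in F | (e `<=` A)%fset]%fset].

(* A spanning subgraph is given by its set of edges F. *)
Definition clar_cover (H : {fset lattice_point}) (F : {fset {fset lattice_point}}) : Prop :=
  (F `<=` hs_edges H)%fset /\
  forall A D, component (hs_verts H) F A D ->
    (exists2 c, c \in H & A = hex_verts c /\ D = hex_edges c) \/
    (exists2 e, e \in hs_edges H & A = e /\ D = [fset e]%fset).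

Definition resonant_pattern (H S : {fset lattice_point}) : Prop :=
  exists2 F, clar_cover H F &
    forall c, c \in S <->
      c \in H /\ component (hs_verts H) F (hex_verts c) (hex_edges c).

Definition sextet_number (H : {fset lattice_point}) (k : nat) : nat :=
  #|` [fset S in fpowerset H | `[< resonant_pattern H S >] & #|` S| == k] |%fset.

Definition clar_number (H : {fset lattice_point}) : nat :=
  \max_(S <- fpowerset H | `[< resonant_pattern H S >]) #|` S|%fset.

Definition sextet_poly (H : {fset lattice_point}) : {poly int} :=
  \sum_(k < (clar_number H).+1) (sextet_number H k)%:R *: 'X^k.

(* The row hexagon h_j is centred at (2 j, 0), so that (4 i - 1, 3) and
   (4 i - 1, - 3) are the centres of the hexagons lying above and below both
   h_(2 i - 1) and h_(2 i).  For n = 0 this is the empty graph, whose sextet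
   polynomial is 1. *)
Definition pyrene_chain (n : nat) : {fset lattice_point} :=
  ([fset ((2 * j)%:Z, 0%:Z) | j in iota 1 (2 * n)] `|`
   [fset ((4 * i)%:Z - 1, 3%:Z) | i in iota 1 n] `|`
   [fset ((4 * i)%:Z - 1, - 3%:Z) | i in iota 1 n])%fset.

Section AsymptoticNormality.
Variable R : realType.
Implicit Types (a : nat -> int -> R) (n : nat) (k : int).

(* The sums over all k are finitely supported sums: each row [a n] is meant to
   vanish outside of a finite set. *)
Definition row_prob a n k : R := a n k / \sum_(j \in [set: int]) a n j.

Definition row_mean a n : R :=
  \sum_(k \in [set: int]) k%:~R * row_prob a n k.

Definition row_variance a n : R :=
  \sum_(k \in [set: int]) (k%:~R - row_mean a n) ^+ 2 * row_prob a n k.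

Definition row_sd a n : R := Num.sqrt (row_variance a n).

Definition central_limit_normal a : Prop :=
  ereal_sup [set `| \sum_(k \in [set k : int |
                            k%:~R <= row_mean a n + x * row_sd a n])
                      row_prob a n k
                    - (Num.sqrt (2 * pi))^-1 *
                      \int[lebesgue_measure]_(t in `]-oo, x])
                        expR (- (t ^+ 2 / 2)) |%:E
            | x in [set: R]] @[n --> \oo] --> 0%:E.

Definition local_limit_normal a : Prop :=
  ereal_sup [set `| row_sd a n *
                      row_prob a n (Num.floor (row_mean a n + x * row_sd a n))
                    - (Num.sqrt (2 * pi))^-1 * expR (- (x ^+ 2 / 2)) |%:E
            | x in [set: R]] @[n --> \oo] --> 0%:E.

Definition pyrene_sextet n k : R :=
  if 0 <= k <= (2 * n)%:Z then (sextet_number (pyrene_chain n) `|k|%N)%:R else 0.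

End AsymptoticNormality.

(* Main.v *)
Require Import Defs.
From HB Require Import structures.
From mathcomp Require Import all_boot all_order all_algebra finmap.
From mathcomp Require Import all_classical all_reals all_analysis.
From mathcomp Require Import measurable_realfun zify ring lra.
Import Order.TTheory GRing.Theory Num.Theory.
Import numFieldNormedType.Exports.
Local Open Scope classical_set_scope.
Local Open Scope ring_scope.
Set Implicit Arguments.
Unset Strict Implicit.
Unset Printing Implicit Defensive.

(** Resonant patterns of the pyrene chain are exactly the sets of pairwise
    disjoint hexagons.  Hexagons of one pattern are components of one graph, hence
    disjoint ([resonant_disjoint]).  Conversely, the vertices of the chain outside
    its upper and lower hexagons form vertical edges, and giving each of these
    hexagons a suitable Kekule structure yields a perfect matching for which all
    hexagons of a prescribed disjoint set are alternating ([pyrene_resonant]).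

    Disjoint sets are counted unit by unit ([packing_sumS]): a unit contributes the
    factor [x ^ 2 + 4 x + 1], and the only interaction between consecutive units is
    the conflict of the two row hexagons that share an edge.  The resulting
    recurrence is used in dual form ([size_sumSS]), for the sum of an arbitrary
    function of the number of hexagons.  Applied to cosines centred at [n], it
    is the Chebyshev recurrence, so the generating function on the unit
    circle is [exp (i n t) U_n (2 + cos t)] ([centered_sum_cos]).  Applied to
    [1], [m] and [m ^ 2] it gives the total mass [U_n 3], the mean [n] and a closed
    form of the variance, which is asymptotic to [sqrt 2 / 4 * n]
    ([row_variance_limit]).

    The distribution thus has the real characteristic function
    [U_n (2 + cos t) / U_n 3] around its mean.  From the closed form of [U_n] in
    terms of the root of [l + 1 / l = 2 y], the rescaled characteristic function
    tends pointwise to [exp (- u ^ 2 / 2)] ([charf_limit]).  Since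
    [U_n y / (y ^ n)] is nondecreasing on [[1, 3]] ([chebU_decay] is the
    comparison with [y = 3]), it is dominated on a period by a fixed Gaussian
    ([charf_bound]).
    Dominated convergence therefore gives convergence in L1 of the characteristic
    functions; by Fourier inversion on the lattice ([fourier_inversion]) and the
    Fourier transform of the Gaussian ([gaussFE]) this bounds the local error
    uniformly, which is the local limit theorem ([local_limit_error]).

    The central limit theorem follows from the local one by Scheffe's argument:
    spread over steps of width [1 / sigma_n], the distribution becomes a density that
    converges pointwise to the normal density, hence in L1
    ([density_error_limit]), and the distribution functions converge
    uniformly ([central_limit_error]). *)

(** * Components of a subgraph of the lattice *)

Section Connectivity.
Implicit Types (V A B : {fset lattice_point}) (F D : {fset {fset lattice_point}}).
Implicit Types u v w : lattice_point.

Lemma connected_by_trans F u v w :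
  connected_by F u v -> connected_by F v w -> connected_by F u w.
Proof.
move=> [p up pv] [q vq qw]; exists (p ++ q); last by rewrite last_cat pv.
by rewrite cat_path up pv.
Qed.

Lemma connected_by_edge F u v : [fset u; v]%fset \in F -> connected_by F u v.
Proof. by move=> uv; exists [:: v] => //=; rewrite uv. Qed.

Lemma connected_by_sym F u v : connected_by F u v -> connected_by F v u.
Proof.
move=> [p]; elim: p u => [|w p IH] u /=; first by move=> _ <-; exists [::].
move=> /andP[uw /IH wp] /wp wv; apply: connected_by_trans wv _.
by apply: connected_by_edge; rewrite fsetUC.
Qed.

Lemma connected_by_closed F A u v :
    (forall x y, x \in A -> [fset x; y]%fset \in F -> y \in A) ->
  u \in A -> connected_by F u v -> v \in A.
Proof.
move=> clA uA [p]; elim: p u uA => [|w p IH] u uA /=; first by move=> _ <-.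
by move=> /andP[/(clA _ _ uA) wA] /(IH _ wA); apply.
Qed.

(** Being joined by a path is an equivalence relation, so components that meet
    coincide.  This is what forces the hexagons of a resonant pattern to be
    pairwise disjoint. *)
Lemma component_uniq V F A D B D' v :
    component V F A D -> component V F B D' -> v \in A -> v \in B ->
  A = B /\ D = D'.
Proof.
move=> [[u _ uA] ->] [[w _ wB] ->] /uA uv /wB wv.
suff -> : A = B by [].
apply/fsetP => x; apply/idP/idP => [/uA ux|/wB wx].
  apply/wB; apply: connected_by_trans wv _.
  by apply: connected_by_trans ux; apply: connected_by_sym.
apply/uA; apply: connected_by_trans uv _.
by apply: connected_by_trans wx; apply: connected_by_sym.
Qed.

End Connectivity.

Lemma hex_vertsE (x y cx cy : int) : ((x, y) \in hex_verts (cx, cy)) =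
  [|| (x == cx) && (y == cy + 2), (x == cx + 1) && (y == cy + 1),
      (x == cx + 1) && (y == cy - 1), (x == cx) && (y == cy - 2),
      (x == cx - 1) && (y == cy - 1) | (x == cx - 1) && (y == cy + 1)].
Proof. by rewrite in_fset /= /hex_corners !inE !xpair_eqE. Qed.

Lemma hex_corners_uniq c : uniq (hex_corners c).
Proof. by case: c => x y; rewrite /= !inE !xpair_eqE; lia. Qed.

(** The extreme ordinates and abscissas of the six corners determine the
    centre. *)
Lemma hex_verts_inj : injective hex_verts.
Proof.
move=> [x y] [x' y'] E.
have [] := (hex_vertsE x (y + 2) x y, hex_vertsE x (y - 2) x y).
have [] := (hex_vertsE (x - 1) (y + 1) x y, hex_vertsE (x + 1) (y + 1) x y).
rewrite E !hex_vertsE !eqxx /= ?orbT => h1 h2 h3 h4.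
by congr (_, _); lia.
Qed.

Lemma card_hex_verts c : #|` hex_verts c|%fset = 6.
Proof. by rewrite card_fseq undup_id // hex_corners_uniq. Qed.

Lemma mem_hex_verts c v : (v \in hex_verts c) = (v \in hex_corners c).
Proof. exact: in_fset. Qed.

Lemma hex_edgesP c e : e \in hex_edges c ->
  exists2 v, v \in e & (e `<=` hex_verts c)%fset.
Proof.
case/imfsetP => v vc ->; exists v; first by rewrite !inE eqxx.
apply/fsubsetP => w; rewrite in_fset2 => /orP[]/eqP->; first exact: vc.
by rewrite mem_hex_verts mem_next -mem_hex_verts.
Qed.

Lemma hex_edges_next c i : (i < 6)%N ->
  [fset nth (0, 0) (hex_corners c) i;
        nth (0, 0) (hex_corners c) (i.+1 %% 6)]%fset \in hex_edges c.
Proof.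
move=> i6; apply/imfsetP; exists (nth (0, 0) (hex_corners c) i).
  by have := mem_hex_verts c (nth (0, 0) (hex_corners c) i); rewrite mem_nth.
congr [fset _; _]%fset.
rewrite next_nth mem_nth // index_uniq // ?hex_corners_uniq // /hex_corners.
by case: i i6 => [|[|[|[|[|[|]]]]]].
Qed.

Lemma hex_connected F c u v : (hex_edges c `<=` F)%fset ->
  u \in hex_verts c -> v \in hex_verts c -> connected_by F u v.
Proof.
move=> /fsubsetP cF.
suff conn w : w \in hex_verts c ->
    connected_by F (nth (0, 0) (hex_corners c) 0) w.
  move=> /conn u0 /conn v0; apply: connected_by_trans v0.
  exact: connected_by_sym.
rewrite mem_hex_verts => /(nthP (0, 0))[i]; rewrite [size _]/= => i6 <-.
elim: i i6 => [_|i IH i6]; first by exists [::].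
apply: connected_by_trans (IH (ltnW i6)) _; apply: connected_by_edge.
by have /cF := hex_edges_next c (ltnW i6); rewrite modn_small.
Qed.

Lemma hs_vertsP (H : {fset lattice_point}) v :
  reflect (exists2 c, c \in H & v \in hex_verts c) (v \in hs_verts H).
Proof.
apply: (iffP (bigfcupP _ _ _ _)) => [[c /andP[cH _] vc]|[c cH vc]];
  by exists c => //; rewrite cH.
Qed.

Lemma hs_edgesP (H : {fset lattice_point}) e :
  reflect (exists2 c, c \in H & e \in hex_edges c) (e \in hs_edges H).
Proof.
apply: (iffP (bigfcupP _ _ _ _)) => [[c /andP[cH _] vc]|[c cH vc]];
  by exists c => //; rewrite cH.
Qed.

(** Meant for two different hexagons: no hexagon is disjoint from itself. *)
Definition hex_disjoint (c d : lattice_point) : bool :=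
  all (fun v => v \notin hex_verts d) (hex_corners c).

Lemma hex_disjointP c d :
  reflect (forall v, v \in hex_verts c -> v \notin hex_verts d)
          (hex_disjoint c d).
Proof.
apply: (iffP allP) => cd v vc; apply: cd; first by rewrite in_fset in vc.
by rewrite in_fset.
Qed.

Definition disjoint_hexes (S : {fset lattice_point}) : bool :=
  [forall c : S, forall d : S, (c != d) ==> hex_disjoint (val c) (val d)].

Lemma disjoint_hexesP (S : {fset lattice_point}) :
  reflect (forall c d v, c \in S -> d \in S ->
             v \in hex_verts c -> v \in hex_verts d -> c = d)
          (disjoint_hexes S).
Proof.
apply: (iffP forallP) => [dS c d v cS dS' vc vd|dS c].
  apply/eqP; apply/negPn/negP => cd.
  have /forallP/(_ [` dS']%fset)/implyP := dS [` cS]%fset.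
  by move=> /(_ cd) /hex_disjointP /(_ v vc); rewrite vd.
apply/forallP => d; apply/implyP => cd; apply/hex_disjointP => v vc.
apply: contra cd => vd; apply/eqP/val_inj.
exact: (dS _ _ _ (valP c) (valP d) vc vd).
Qed.

(** The hexagons of a resonant pattern are components of one and the same
    subgraph. *)
Lemma resonant_disjoint H S : resonant_pattern H S ->
  (S `<=` H)%fset /\ disjoint_hexes S.
Proof.
move=> [F _ SF]; split; first by apply/fsubsetP => c /SF[].
apply/disjoint_hexesP => c d v /SF[_ cF] /SF[_ dF] vc vd.
by apply: hex_verts_inj; case: (component_uniq cF dF vc vd).
Qed.

(** * Disjoint hexagons alternating for a perfect matching *)

(** Here [m] sends each vertex to its partner in a perfect matching of the
    system, and [mS] says that every hexagon of [S] is a union of matching pairs.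
    Removing these hexagons then leaves a perfectly matched graph, so [S]
    together with the remaining matching edges is a Clar cover. *)
Section AlternatingMatching.
Variables (H S : {fset lattice_point}) (m : lattice_point -> lattice_point).
Hypothesis SH : (S `<=` H)%fset.
Hypothesis dS : disjoint_hexes S.
Hypothesis mK : forall v, v \in hs_verts H -> m (m v) = v.
Hypothesis mE : forall v, v \in hs_verts H -> [fset v; m v]%fset \in hs_edges H.
Hypothesis mS : forall c v, c \in S -> v \in hex_verts c -> m v \in hex_verts c.

Let V := hs_verts H.
Let covered v := v \in hs_verts S.
Let F := (hs_edges S `|` [fset [fset v; m v] | v in [fset v in V | ~~ covered v]])%fset.

Let FP e : e \in F -> (exists2 c, c \in S & e \in hex_edges c) \/
  (exists v, [/\ v \in V, ~~ covered v & e = [fset v; m v]%fset]).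
Proof.
rewrite inE => /orP[/hs_edgesP|/imfsetP[v /=]]; first by left.
by rewrite !inE => /andP[vV vS] ->; right; exists v.
Qed.

(** Partners of uncovered vertices are uncovered, [m] being an involution that
    preserves each hexagon of [S]; hence the edges of the cover never join a
    hexagon of [S] to the rest. *)
Let mC v : v \in V -> ~~ covered v -> ~~ covered (m v).
Proof.
move=> vV; apply: contra => /hs_vertsP[c cS vc]; apply/hs_vertsP; exists c => //.
by rewrite -(mK vV) mS.
Qed.

Let hex_edgesF c : c \in S -> (hex_edges c `<=` F)%fset.
Proof.
move=> cS; apply/fsubsetP => e ec; rewrite inE; apply/orP; left.
by apply/hs_edgesP; exists c.
Qed.

Let hex_component c : c \in S -> component V F (hex_verts c) (hex_edges c).
Proof.
move=> cS; have cH := fsubsetP SH _ cS; split.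
  pose u := nth (0, 0) (hex_corners c) 0.
  have uc : u \in hex_verts c by rewrite mem_hex_verts mem_nth.
  exists u; first by apply/hs_vertsP; exists c.
  move=> v; split=> [vc|]; first exact: hex_connected (hex_edgesF cS) uc vc.
  apply: connected_by_closed uc => x y xc /FP[[d dS' ed]|[w [wV wS xyw]]].
    have [_ _ /fsubsetP sub] := hex_edgesP ed.
    have xd : x \in hex_verts d by apply: sub; rewrite !inE eqxx.
    have -> : c = d by apply: (disjoint_hexesP _ dS) xc xd.
    by apply: sub; rewrite !inE eqxx orbT.
  have : x \in [fset w; m w]%fset by rewrite -xyw !inE eqxx.
  have cx : covered x by apply/hs_vertsP; exists c.
  by rewrite !inE => /orP[]/eqP xw; move: cx; rewrite xw ?(negbTE wS)
     ?(negbTE (mC wV wS)).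
apply/fsetP => e; rewrite in_fset inE; apply/idP/andP => [ec|[]].
  by split; [apply: (fsubsetP (hex_edgesF cS))|have [] := hex_edgesP ec].
move=> /FP[[d dS' ed]|[w [wV wS ->]]] /fsubsetP ec; last first.
  by case/negP: wS; apply/hs_vertsP; exists c => //; apply: ec; rewrite !inE eqxx.
have [v ve /fsubsetP sub] := hex_edgesP ed.
suff -> : c = d by [].
by apply: (disjoint_hexesP _ dS) (ec _ ve) (sub _ ve).
Qed.

Let edge_component v : v \in V -> ~~ covered v ->
  component V F [fset v; m v]%fset [fset [fset v; m v]]%fset.
Proof.
move=> vV vS; have mvS := mC vV vS.
have vF : [fset v; m v]%fset \in F.
  rewrite inE; apply/orP; right; apply/imfsetP; exists v => //=.
  by rewrite !inE vV vS.
split.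
  exists v => // x; split.
    rewrite !inE => /orP[]/eqP->; first by exists [::].
    exact: connected_by_edge.
  apply: connected_by_closed; last by rewrite !inE eqxx.
  move=> y z yv /FP[[d dS' ed]|[w [wV wS yzw]]].
    have [_ _ /fsubsetP sub] := hex_edgesP ed.
    have yd : y \in hex_verts d by apply: sub; rewrite !inE eqxx.
    have : covered y by apply/hs_vertsP; exists d.
    move: yv; rewrite !inE => /orP[]/eqP->; first by rewrite (negbTE vS).
    by rewrite (negbTE mvS).
  have [yw zw] : y \in [fset w; m w]%fset /\ z \in [fset w; m w]%fset.
    by rewrite -yzw !inE !eqxx orbT.
  have wm := mK wV; have vm := mK vV.
  move: yv yw zw; rewrite !inE.
  by move=> /orP[]/eqP-> /orP[]/eqP yw /orP[]/eqP zw; subst z;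
    rewrite ?yw ?wm ?eqxx ?orbT //;
    try (by rewrite -wm -yw vm ?eqxx ?orbT);
    try (by rewrite -yw vm ?eqxx ?orbT).
apply/fsetP => e; rewrite in_fset1 in_fset inE; apply/eqP/andP => [->//|[]].
move=> /FP[[d dS' ed]|[w [wV wS ->]]] /fsubsetP ev.
  have [x xe /fsubsetP sub] := hex_edgesP ed.
  have : covered x by apply/hs_vertsP; exists d => //; apply: sub.
  have := ev _ xe; rewrite !inE => /orP[]/eqP->; first by rewrite (negbTE vS).
  by rewrite (negbTE mvS).
have /ev : w \in [fset w; m w]%fset by rewrite !inE eqxx.
by rewrite !inE => /orP[]/eqP-> //; rewrite mK // fsetUC.
Qed.

Lemma alternating_resonant : resonant_pattern H S.
Proof.
have cover v : v \in V -> (exists2 c, c \in S & v \in hex_verts c) \/ ~~ covered v.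
  move=> vV; have [/hs_vertsP ?|?] := boolP (covered v); [by left|by right].
exists F; last first.
  move=> c; split=> [cS|[cH comp]].
    by split; [apply: (fsubsetP SH)|apply: hex_component].
  pose u := nth (0, 0) (hex_corners c) 0.
  have uc : u \in hex_verts c by rewrite mem_hex_verts mem_nth.
  have uV : u \in V by apply/hs_vertsP; exists c.
  have [[d dS' ud]|uS] := cover _ uV.
    have [/hex_verts_inj -> //] := component_uniq comp (hex_component dS') uc ud.
  have uu : u \in [fset u; m u]%fset by rewrite !inE eqxx.
  have [E _] := component_uniq comp (edge_component uV uS) uc uu.
  by have := card_hex_verts c; rewrite E cardfs2; case: (_ == _).
split.
  apply/fsubsetP => e /FP[[c cS ec]|[v [vV _ ->]]]; last exact: mE.
  by apply/hs_edgesP; exists c => //; apply: (fsubsetP SH).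
move=> A D comp; have [[u uV uA] _] := comp.
have {}uA : u \in A by apply/uA; exists [::].
have [[c cS uc]|uS] := cover _ uV.
  left; exists c; first exact: (fsubsetP SH).
  exact: component_uniq comp (hex_component cS) uA uc.
right; exists [fset u; m u]%fset; first exact: mE.
by apply: component_uniq comp (edge_component uV uS) uA _; rewrite !inE eqxx.
Qed.

End AlternatingMatching.

(** * Resonant patterns of the pyrene chain *)

Definition pyrene_unit (i : int) : seq lattice_point :=
  [:: (4 * i - 2, 0); (4 * i, 0); (4 * i - 1, 3); (4 * i - 1, - 3)].

Lemma pyrene_unitP i c : c \in pyrene_unit i ->
  [\/ c = (4 * i - 2, 0), c = (4 * i, 0), c = (4 * i - 1, 3) | c = (4 * i - 1, - 3)].
Proof.
by rewrite !inE => /or4P[]/eqP->; [constructor 1|constructor 2|constructor 3|constructor 4].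
Qed.

Lemma pyrene_chainP n c : reflect
  (exists i : int, 1 <= i <= n%:Z /\ c \in pyrene_unit i)
  (c \in pyrene_chain n).
Proof.
case: c => x y; apply: (iffP idP).
  rewrite !in_fsetU => /orP[/orP[]|] /imfsetP[j /=]; rewrite mem_iota => jn [-> ->].
  - exists (j.+1 %/ 2)%N%:Z.
    rewrite !inE !xpair_eqE; split; lia.
  - by exists j%:Z; rewrite !inE !xpair_eqE; split; lia.
  - by exists j%:Z; rewrite !inE !xpair_eqE; split; lia.
case=> i [i1n]; have [k ik] : exists k : nat, i = k%:Z by exists `|i|%N; lia.
subst i; rewrite !inE !xpair_eqE.
move=> /or4P[] /andP[/eqP-> /eqP->].
- apply/orP; left; apply/orP; left; apply/imfsetP; exists (2 * k - 1)%N => /=.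
    by rewrite mem_iota; lia.
  by congr (_, _); lia.
- apply/orP; left; apply/orP; left; apply/imfsetP; exists (2 * k)%N => /=.
    by rewrite mem_iota; lia.
  by congr (_, _); lia.
- by apply/orP; left; apply/orP; right; apply/imfsetP; exists k => //=; rewrite mem_iota; lia.
- by apply/orP; right; apply/imfsetP; exists k => //=; rewrite mem_iota; lia.
Qed.

(** The perfect matching used for the pyrene chain.  Its vertices split into the
    vertical edges on the lines [x = 4 i + 1] and the vertices of the outer
    hexagons of the units.  The vertical edges are matching edges, and both outer
    hexagons of unit [i] carry one of their two Kekule structures, namely the
    one chosen by [k i].  The affine formulas in the ordinate [y] parametrize these
    structures simultaneously above ([sgz y = 1]) and below the row. *)
Definition kekule_partner (k : int -> bool) (v : lattice_point) : lattice_point :=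
  let i := ((v.1 + 2) %/ 4)%Z in let y := v.2 in
  if v.1 == 4 * i - 2 then
    if k i then (4 * i - 1, 2 * y - 3 * sgz y) else (4 * i - 2, 6 * sgz y - y)
  else if v.1 == 4 * i - 1 then
    if k i then (4 * i - 2, ((y + 3 * sgz y) %/ 2)%Z)
    else (4 * i, ((y + 3 * sgz y) %/ 2)%Z)
  else if v.1 == 4 * i then
    if k i then (4 * i, 6 * sgz y - y) else (4 * i - 1, 2 * y - 3 * sgz y)
  else (v.1, - y).

Lemma kekule_partnerE k i :
  [/\ forall y, kekule_partner k (4 * i + 1, y) = (4 * i + 1, - y),
      forall y, kekule_partner k (4 * i - 2, y) =
        if k i then (4 * i - 1, 2 * y - 3 * sgz y) else (4 * i - 2, 6 * sgz y - y),
      forall y, kekule_partner k (4 * i - 1, y) =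
        (if k i then 4 * i - 2 else 4 * i, ((y + 3 * sgz y) %/ 2)%Z) &
      forall y, kekule_partner k (4 * i, y) =
        if k i then (4 * i, 6 * sgz y - y) else (4 * i - 1, 2 * y - 3 * sgz y)].
Proof.
rewrite /kekule_partner; split=> y /=.
- have -> : ((4 * i + 1 + 2) %/ 4)%Z = i by lia.
  by rewrite !ifN //; lia.
- have -> : ((4 * i - 2 + 2) %/ 4)%Z = i by lia.
  by rewrite eqxx.
- have -> : ((4 * i - 1 + 2) %/ 4)%Z = i by lia.
  rewrite ifN; last by lia.
  by rewrite eqxx; case: (k i).
- have -> : ((4 * i + 2) %/ 4)%Z = i by lia.
  rewrite ifN; last by lia.
  rewrite ifN; last by lia.
  by rewrite eqxx.
Qed.

(** A Kekule structure of a hexagon, on the indices of its corners: corners with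
    even index are matched forwards and those with odd index backwards when
    [b = false], and the other way round when [b = true]. *)
Definition kekule_step (b : bool) (j : nat) : nat := ((j + (if odd j (+) b then 5 else 1)) %% 6)%N.

Lemma kekule_step_lt b j : (kekule_step b j < 6)%N. Proof. exact: ltn_pmod. Qed.

Lemma kekule_stepK b j : (j < 6)%N -> kekule_step b (kekule_step b j) = j.
Proof. by case: b; case: j => [|[|[|[|[|[|]]]]]]. Qed.

Lemma hex_edges_step c b j : (j < 6)%N ->
  [fset nth (0, 0) (hex_corners c) j;
        nth (0, 0) (hex_corners c) (kekule_step b j)]%fset \in hex_edges c.
Proof.
move=> j6; rewrite /kekule_step; case: (odd j (+) b); last first.
  by rewrite addn1 hex_edges_next.
have := hex_edges_next c (ltn_pmod (j + 5) (isT : (0 < 6)%N)).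
rewrite fsetUC -[((_ %% 6).+1)]addn1 modnDml -addnA modnDr.
by rewrite (modn_small j6).
Qed.

Lemma kekule_partner_hex k i (c : lattice_point) j : (j < 6)%N ->
  c = (4 * i - 1, 3) \/ c = (4 * i - 1, - 3) ->
  kekule_partner k (nth (0, 0) (hex_corners c) j) =
  nth (0, 0) (hex_corners c) (kekule_step (k i) j).
Proof.
have [_ m0 m1 m2] := kekule_partnerE k i.
have E1 : 4 * i - 1 + 1 = 4 * i by lia.
have E2 : 4 * i - 1 - 1 = 4 * i - 2 by lia.
move=> + cE; case: cE => -> /=; rewrite /hex_corners /= !E1 !E2;
 case: j => [|[|[|[|[|[|//]]]]]] _ /=; rewrite ?m0 ?m1 ?m2; by case: (k i).
Qed.

Lemma in_hex_cornersP c v : reflect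
  (exists2 j, (j < 6)%N & v = nth (0, 0) (hex_corners c) j) (v \in hex_verts c).
Proof.
rewrite mem_hex_verts; apply: (iffP (nthP (0, 0))) => [] [j j6 jv];
  by exists j.
Qed.

(** A vertex of a row hexagon that lies on no vertical line [x = 4 i + 1] belongs
    to the upper or lower hexagon of its unit. *)
Lemma pyrene_vertsP n v : v \in hs_verts (pyrene_chain n) ->
  (exists i : int, [/\ (0 < n)%N, 0 <= i <= n%:Z &
                       v = (4 * i + 1, 1) \/ v = (4 * i + 1, - 1)]) \/
  (exists i c, [/\ 1 <= i <= n%:Z, c = (4 * i - 1, 3) \/ c = (4 * i - 1, - 3)
                  & v \in hex_verts c]).
Proof.
move=> /hs_vertsP[c /pyrene_chainP[i [i1n /pyrene_unitP cE]]]; case: v => x y.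
case: cE => ->; rewrite hex_vertsE => h.
- have [xi|xi] := eqVneq x (4 * (i - 1) + 1).
    left; exists (i - 1); split; [lia|lia|].
    have yE : y = 1 \/ y = - 1 by lia.
    by rewrite xi; case: yE => ->; [left|right].
  right; have [y0|y0] := leP 0 y.
    by exists i, (4 * i - 1, 3); split; [|left|rewrite hex_vertsE; lia].
  by exists i, (4 * i - 1, - 3); split; [|right|rewrite hex_vertsE; lia].
- have [xi|xi] := eqVneq x (4 * i + 1).
    left; exists i; split; [lia|lia|].
    have yE : y = 1 \/ y = - 1 by lia.
    by rewrite xi; case: yE => ->; [left|right].
  right; have [y0|y0] := leP 0 y.
    by exists i, (4 * i - 1, 3); split; [|left|rewrite hex_vertsE; lia].
  by exists i, (4 * i - 1, - 3); split; [|right|rewrite hex_vertsE; lia].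
- by right; exists i, (4 * i - 1, 3); split; [|left|rewrite hex_vertsE; lia].
- by right; exists i, (4 * i - 1, - 3); split; [|right|rewrite hex_vertsE; lia].
Qed.

(** Choose in unit [i] the Kekule structure that pairs up the vertices of
    [h_(2 i - 1)] if that hexagon belongs to [S], and otherwise the one that pairs
    up those of [h_(2 i)].  Both row hexagons of a unit share an edge, so at most
    one of them is in [S]; hence every hexagon of [S] is alternating for the
    resulting matching. *)
Lemma pyrene_resonant n (S : {fset lattice_point}) :
  (S `<=` pyrene_chain n)%fset -> disjoint_hexes S ->
  resonant_pattern (pyrene_chain n) S.
Proof.
move=> SH dS.
pose k (i : int) := (4 * i - 2, 0 : int) \in S.
have unitH (i : int) (c : lattice_point) : 1 <= i <= n%:Z ->
    c \in pyrene_unit i -> c \in pyrene_chain n.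
  by move=> i1n ci; apply/pyrene_chainP; exists i.
have outerH (i : int) (c : lattice_point) : 1 <= i <= n%:Z ->
    c = (4 * i - 1, 3) \/ c = (4 * i - 1, - 3) ->
    c \in pyrene_chain n.
  by move=> i1n cE; apply: (unitH i) => //; case: cE => ->; rewrite !inE eqxx ?orbT.
(* The vertical edge on x = 4 i + 1 bounds h_(2 i) or, for i = 0, h_1. *)
have cutH (i : int) : (0 < n)%N -> 0 <= i <= n%:Z ->
    exists2 c, c \in pyrene_chain n &
      [fset (4 * i + 1, 1)%R; (4 * i + 1, - 1)%R]%fset \in hex_edges c.
  move=> n0 i0n; have [i0|i0] := eqVneq i 0.
    exists (2, 0); first by apply: (unitH 1); [lia|rewrite !inE].
    by have := @hex_edges_next (2, 0) 4 isT; rewrite i0 fsetUC.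
  exists (4 * i, 0); first by apply: (unitH i); [lia|rewrite !inE eqxx orbT].
  exact: (@hex_edges_next (4 * i, 0) 1 isT).
apply: (@alternating_resonant _ S (kekule_partner k)) => //.
- move=> v /pyrene_vertsP[[i [n0 i0n vE]]|[i [c [i1n cE /in_hex_cornersP[j j6 ->]]]]].
    have [mc _ _ _] := kekule_partnerE k i.
    by case: vE => ->; rewrite !mc.
  by rewrite !(kekule_partner_hex _ _ cE) ?kekule_step_lt ?kekule_stepK.
- move=> v /pyrene_vertsP[[i [n0 i0n vE]]|[i [c [i1n cE /in_hex_cornersP[j j6 ->]]]]].
    have [c cH e] := cutH i n0 i0n.
    have [mc _ _ _] := kekule_partnerE k i.
    apply/hs_edgesP; exists c => //.
    by case: vE => ->; rewrite mc //= fsetUC.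
  apply/hs_edgesP; exists c; first exact: outerH cE.
  by rewrite (kekule_partner_hex _ j6 cE) hex_edges_step.
- move=> c v cS; have /pyrene_chainP[i [i1n /pyrene_unitP cE]] := fsubsetP SH _ cS.
  have [_ m0 m1 m2] := kekule_partnerE k i.
  have outer : c = (4 * i - 1, 3) \/ c = (4 * i - 1, - 3) ->
      v \in hex_verts c -> kekule_partner k v \in hex_verts c.
    move=> co /in_hex_cornersP[j j6 ->]; rewrite (kekule_partner_hex _ j6 co).
    by apply/in_hex_cornersP; exists (kekule_step (k i) j) => //; apply: kekule_step_lt.
  case: cE => cE; [| |by apply: outer; left|by apply: outer; right].
  + have ki : k i by rewrite /k -cE.
    have [mc _ _ _] := kekule_partnerE k (i - 1).
    have E1 : 4 * i - 2 + 1 = 4 * i - 1 by lia.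
    have E2 : 4 * i - 2 - 1 = 4 * (i - 1) + 1 by lia.
    rewrite cE => /in_hex_cornersP[j j6 ->]; rewrite /hex_corners /= E1 E2.
    by case: j j6 => [|[|[|[|[|[|//]]]]]] _ /=;
      rewrite ?m0 ?m1 ?mc ?ki hex_vertsE //=; lia.
  + have ki : k i = false.
      apply/negP => ki.
      have sh : (4 * i - 1, 1) \in hex_verts (4 * i - 2, 0).
        by rewrite hex_vertsE; lia.
      have /(disjoint_hexesP _ dS _ _ _ ki cS sh) : (4 * i - 1, 1) \in hex_verts c.
        by rewrite cE hex_vertsE; lia.
      by rewrite cE => -[]; lia.
    have [mc _ _ _] := kekule_partnerE k i.
    rewrite cE => /in_hex_cornersP[j j6 ->]; rewrite /hex_corners /=.
    by case: j j6 => [|[|[|[|[|[|//]]]]]] _ /=;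
      rewrite ?m1 ?m2 ?mc ?ki hex_vertsE //=; lia.
Qed.

(** * Counting sets of disjoint hexagons *)

Lemma big_fpowersetU1 (K : choiceType) (V : nmodType) (H : {fset K}) c
    (g : {fset K} -> V) : c \notin H ->
  \sum_(S <- fpowerset (c |` H)%fset) g S =
  \sum_(S <- fpowerset H) (g S + g (c |` S)%fset).
Proof.
move=> cH.
have cS S : S \in fpowerset H -> c \notin S.
  by rewrite fpowersetE => /fsubsetP SH; apply: contra cH; apply: SH.
rewrite big_split /= -(big_map (fun S => c |` S)%fset xpredT g) -big_cat /=.
apply: perm_big; apply: uniq_perm; first exact: fset_uniq.
  rewrite cat_uniq fset_uniq map_inj_in_uniq ?fset_uniq ?andbT /=; last first.
    by move=> S T SH TH E; rewrite -(fsetU1K (cS S SH)) E fsetU1K // cS.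
  apply/hasPn => _ /mapP[S SH ->]; apply/negP => /cS.
  by rewrite fset1U1.
move=> S; rewrite mem_cat fpowersetE; apply/idP/orP.
  move=> ScH; have [cS'|cS'] := boolP (c \in S); [right|left].
    apply/mapP; exists (S `\ c)%fset; last by rewrite fsetD1K.
    by rewrite fpowersetE fsubDset.
  rewrite fpowersetE; apply/fsubsetP => d dS; have := fsubsetP ScH _ dS.
  by rewrite in_fset1U => /predU1P[dc|//]; rewrite -dc dS in cS'.
rewrite fpowersetE; case=> [SH|/mapP[T]].
  by apply: fsubset_trans SH _; apply: fsubsetU1.
by rewrite fpowersetE => TH ->; apply: fsetUS.
Qed.

Lemma disjoint_hexesU1 c (S : {fset lattice_point}) : c \notin S ->
  disjoint_hexes (c |` S)%fset = disjoint_hexes S && all (hex_disjoint c) S.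
Proof.
move=> cS; apply/disjoint_hexesP/andP => [dS|[dS /allP cd] x y v].
  split; first by apply/disjoint_hexesP => x y v xS yS;
    apply: dS; rewrite !in_fsetU ?xS ?yS orbT.
  apply/allP => d dS'; apply/hex_disjointP => v vc; apply/negP => vd.
  have E : c = d by apply: (dS _ _ v _ _ vc vd); rewrite in_fset1U ?eqxx ?dS' ?orbT.
  by rewrite E dS' in cS.
rewrite !in_fset1U => /predU1P[->|xS] /predU1P[->|yS] //.
- by move=> vc vy; have /hex_disjointP/(_ v vc) := cd _ yS; rewrite vy.
- by move=> vx vc; have /hex_disjointP/(_ v vc) := cd _ xS; rewrite vx.
- by apply: (disjoint_hexesP _ dS).
Qed.

Lemma disjoint_hexesU1F c d (S : {fset lattice_point}) :
  d \in S -> c != d -> hex_disjoint c d = false ->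
  disjoint_hexes (c |` S)%fset = false.
Proof.
move=> dS cd /negP ncd; apply/disjoint_hexesP => h; case: ncd.
apply/hex_disjointP => v vc; apply/negP => vd; case/eqP: cd.
by apply: (h _ _ v) vc vd; rewrite in_fset1U ?eqxx ?dS ?orbT.
Qed.

Lemma all_fsetU1 (K : choiceType) (p : pred K) c (S : {fset K}) :
  all p (c |` S)%fset = p c && all p S.
Proof.
apply/allP/andP => [h|[pc /allP h] x].
  split; first by apply: h; rewrite fset1U1.
  by apply/allP => x xS; apply: h; rewrite in_fset1U xS orbT.
by rewrite in_fset1U => /predU1P[->|/h].
Qed.

Lemma pyrene_chainS n : pyrene_chain n.+1 =
  ((4 * n%:Z + 2, 0)%R |` ((4 * n%:Z + 4, 0)%R |` ((4 * n%:Z + 3, - 3)%R |`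
  ((4 * n%:Z + 3, 3)%R |` pyrene_chain n))))%fset.
Proof.
apply/fsetP => -[x y]; rewrite !in_fset1U !xpair_eqE.
apply/pyrene_chainP/idP => [[i [i1n]]|].
  have [->|ni] := eqVneq i (n%:Z + 1).
    by move/pyrene_unitP => [] [-> ->]; lia.
  move=> ci; apply/orP; right; apply/orP; right; apply/orP; right.
  by apply/orP; right; apply/pyrene_chainP; exists i; split => //; lia.
move=> /or4P[|||/orP[|]]; try (move=> xy; exists (n%:Z + 1);
  rewrite !inE !xpair_eqE; split; lia).
by move=> /pyrene_chainP[i [i1n ci]]; exists i; split => //; lia.
Qed.

Definition packing_sum (V : nmodType) n (g : {fset lattice_point} -> V) : V :=
  \sum_(S <- fpowerset (pyrene_chain n) | disjoint_hexes S) g S.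

(** Only bounds: enough to see which hexagons of a further unit are far away. *)
Lemma mem_pyrene_chain n x y : (x, y) \in pyrene_chain n ->
  [/\ 2 <= x <= 4 * n%:Z, - 3 <= y <= 3 & y != 0 -> x <= 4 * n%:Z - 1].
Proof.
by move=> /pyrene_chainP[i [i1n /pyrene_unitP[] [-> ->]]]; split; lia.
Qed.

Lemma hex_verts_bounds c v : v \in hex_verts c ->
  (c.1 - 1 <= v.1 <= c.1 + 1) && (c.2 - 2 <= v.2 <= c.2 + 2).
Proof. by case: c v => x y [x' y']; rewrite hex_vertsE /=; lia. Qed.

Lemma hex_disjoint_x (c d : lattice_point) : d.1 + 3 <= c.1 -> hex_disjoint c d.
Proof.
move=> cd; apply/hex_disjointP => v /hex_verts_bounds vc; apply/negP.
by move=> /hex_verts_bounds; lia.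
Qed.

Lemma hex_not_disjoint c d v :
  v \in hex_verts c -> v \in hex_verts d -> hex_disjoint c d = false.
Proof. by move=> vc vd; apply/negP => /hex_disjointP/(_ v vc); rewrite vd. Qed.

Lemma hex_disjoint_far n (c d : lattice_point) : d \in pyrene_chain n ->
  4 * n%:Z + 3 <= c.1 -> hex_disjoint c d.
Proof.
case: c d => x y [x' y'] /mem_pyrene_chain[? ? ?] /= cx.
by apply: hex_disjoint_x => /=; lia.
Qed.

(** The first row hexagon of unit [n + 1] touches the chain of length [n] only
    along the right edge of the last row hexagon [h_(2 n)]. *)
Lemma hex_disjoint_row n (d : lattice_point) : d \in pyrene_chain n ->
  hex_disjoint (4 * n%:Z + 2, 0) d = (d != (4 * n%:Z, 0)).
Proof.
case: d => x y dP.
have par : y = 0 -> 4 * n%:Z - 2 < x -> x = 4 * n%:Z.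
  move: dP => /pyrene_chainP[i [i1n /pyrene_unitP[] [-> ->]]]; lia.
have [? ? ?] := mem_pyrene_chain dP.
have [->|dE] := eqVneq (x, y) (4 * n%:Z, 0).
  by rewrite (@hex_not_disjoint _ _ (4 * n%:Z + 1, 1)) // hex_vertsE; lia.
by apply: hex_disjoint_x; move: dE; rewrite xpair_eqE /=; lia.
Qed.

(** Transfer from length [n] to [n + 1].  Inside a unit the upper and lower
    hexagons are disjoint from one another and any other two hexagons meet, so
    the new part of a disjoint set is one of the six sets: empty, [t], [b],
    [t] and [b], [h'], [h]; and [h] is excluded when [h_(2 n)] is already taken. *)
Lemma packing_sumS (V : nmodType) n (g : {fset lattice_point} -> V) :
  let t := (4 * n%:Z + 3, 3)%R in let b := (4 * n%:Z + 3, - 3)%R in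
  let h := (4 * n%:Z + 2, 0)%R in let h' := (4 * n%:Z + 4, 0)%R in
  packing_sum n.+1 g =
  packing_sum n (fun S => g S + g (t |` S)%fset + g (b |` S)%fset
    + g (b |` (t |` S))%fset + g (h' |` S)%fset
    + (if (4 * n%:Z, 0) \in S then 0 else g (h |` S)%fset)).
Proof.
move=> t b h h'.
have nin : [/\ b != t, h' != t, h' != b, h != t & (h != b) && (h != h')].
  by rewrite !xpair_eqE; split; lia.
have far : [/\ t \notin pyrene_chain n, b \notin pyrene_chain n,
    h \notin pyrene_chain n & h' \notin pyrene_chain n].
  by clear nin; split; apply/negP => /mem_pyrene_chain[]; lia.
have dbt : hex_disjoint b t.
  apply/hex_disjointP => v /hex_verts_bounds vb; apply/negP => /hex_verts_bounds.
  by clear -vb; move: vb => /=; lia.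
have touch : [/\ hex_disjoint h' t = false, hex_disjoint h' b = false,
    hex_disjoint h t = false, hex_disjoint h b = false & hex_disjoint h h' = false].
  clear nin far dbt; split;
    [apply: (@hex_not_disjoint _ _ (4 * n%:Z + 3, 1))
    |apply: (@hex_not_disjoint _ _ (4 * n%:Z + 3, - 1))
    |apply: (@hex_not_disjoint _ _ (4 * n%:Z + 3, 1))
    |apply: (@hex_not_disjoint _ _ (4 * n%:Z + 3, - 1))
    |apply: (@hex_not_disjoint _ _ (4 * n%:Z + 3, 1))]; rewrite hex_vertsE; lia.
case: nin => e1 e2 e3 e4 /andP[e5 e6].
case: far => nt nb nh nh'; case: touch => dh't dh'b dht dhb dhh'.
rewrite /packing_sum pyrene_chainS -/t -/b -/h -/h'.
have bt : b \notin (t |` pyrene_chain n)%fset.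
  by rewrite in_fset1U negb_or e1.
have h'bt : h' \notin (b |` (t |` pyrene_chain n))%fset.
  by rewrite !in_fset1U !negb_or; apply/and3P; split.
have hh'bt : h \notin (h' |` (b |` (t |` pyrene_chain n)))%fset.
  by rewrite !in_fset1U; do 3!(apply/norP; split=> //).
rewrite big_mkcond !big_fpowersetU1 // [RHS]big_mkcond /=.
rewrite [LHS]big_seq [RHS]big_seq; apply: eq_bigr => S; rewrite fpowersetE => SP.
have sub c : c \notin pyrene_chain n -> c \notin S.
  by apply: contra => /(fsubsetP SP).
have St := sub _ nt; have Sb := sub _ nb.
have Sh := sub _ nh; have Sh' := sub _ nh'.
have far c : 4 * n%:Z + 3 <= c.1 -> all (hex_disjoint c) S.
  by move=> cx; apply/allP => d /(fsubsetP SP) dP; apply: hex_disjoint_far dP cx.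
have ft : all (hex_disjoint t) S by apply: far.
have fb : all (hex_disjoint b) S by apply: far.
have fh' : all (hex_disjoint h') S by apply: far; rewrite lerD2l.
have fh : all (hex_disjoint h) S = ((4 * n%:Z, 0) \notin S).
  apply/allP/idP => [hS|nS d dS].
    by apply/negP => /[dup] dS /hS; rewrite (hex_disjoint_row (fsubsetP SP _ dS)) eqxx.
  rewrite (hex_disjoint_row (fsubsetP SP _ dS)); apply: contra nS.
  by move=> /eqP <-.
have Dt : disjoint_hexes (t |` S)%fset = disjoint_hexes S.
  by rewrite disjoint_hexesU1 // ft andbT.
have Db : disjoint_hexes (b |` S)%fset = disjoint_hexes S.
  by rewrite disjoint_hexesU1 // fb andbT.
have Dbt : disjoint_hexes (b |` (t |` S))%fset = disjoint_hexes S.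
  rewrite disjoint_hexesU1; last by rewrite in_fset1U; apply/norP; split.
  by rewrite all_fsetU1 dbt fb !andbT.
have Dh' : disjoint_hexes (h' |` S)%fset = disjoint_hexes S.
  by rewrite disjoint_hexesU1 // fh' andbT.
have Dh : disjoint_hexes (h |` S)%fset = disjoint_hexes S && ((4 * n%:Z, 0) \notin S).
  by rewrite disjoint_hexesU1 // fh.
rewrite Dt Db Dbt Dh' Dh.
rewrite ![disjoint_hexes (h' |` (t |` S))%fset](disjoint_hexesU1F _ e2 dh't) ?fset1U1 //.
rewrite ![disjoint_hexes (h' |` (b |` S))%fset](disjoint_hexesU1F _ e3 dh'b) ?fset1U1 //.
rewrite ![disjoint_hexes (h' |` (b |` (t |` S)))%fset](disjoint_hexesU1F _ e3 dh'b) ?fset1U1 //.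
rewrite ![disjoint_hexes (h |` (t |` S))%fset](disjoint_hexesU1F _ e4 dht) ?fset1U1 //.
rewrite ![disjoint_hexes (h |` (b |` S))%fset](disjoint_hexesU1F _ e5 dhb) ?fset1U1 //.
rewrite ![disjoint_hexes (h |` (b |` (t |` S)))%fset](disjoint_hexesU1F _ e5 dhb) ?fset1U1 //.
have Dhh' T : disjoint_hexes (h |` (h' |` T))%fset = false.
  by apply: (disjoint_hexesU1F _ e6 dhh'); rewrite fset1U1.
rewrite !Dhh' !addr0.
case: (disjoint_hexes S) => /=; rewrite ?addr0 //.
by rewrite if_neg [LHS](AC (4*2) (1*5*4*6*3*2)).
Qed.

Lemma eq_packing_sum (V : nmodType) n (g1 g2 : {fset lattice_point} -> V) :
  (forall S, (S `<=` pyrene_chain n)%fset -> g1 S = g2 S) ->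
  packing_sum n g1 = packing_sum n g2.
Proof.
move=> g12; rewrite /packing_sum [LHS]big_seq_cond [RHS]big_seq_cond.
by apply: eq_bigr => S /andP[+ _]; rewrite fpowersetE => /g12.
Qed.

(** Sum of [f] over all disjoint sets of hexagons, each evaluated at its number of
    elements.  It serves as a linear functional of [f]: generating polynomial,
    moments and characteristic function arise by varying [f] in the same
    recurrence. *)
Definition size_sum (V : nmodType) n (f : nat -> V) : V :=
  packing_sum n (fun S => f #|` S|%fset).

Lemma eq_size_sum (V : nmodType) n (f1 f2 : nat -> V) :
  f1 =1 f2 -> size_sum n f1 = size_sum n f2.
Proof. by move=> f12; apply: eq_packing_sum => S _; rewrite f12. Qed.

Lemma size_sumD (V : nmodType) n (f1 f2 : nat -> V) :
  size_sum n (fun k => f1 k + f2 k) = size_sum n f1 + size_sum n f2.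
Proof. exact: big_split. Qed.

Lemma size_sumZ (V : pzRingType) n a (f : nat -> V) :
  size_sum n (fun k => a * f k) = a * size_sum n f.
Proof. by rewrite /size_sum /packing_sum mulr_sumr. Qed.

Lemma pyrene_chain0 : pyrene_chain 0 = fset0.
Proof.
by apply/fsetP => c; apply/negP => /pyrene_chainP[i [+ _]]; lia.
Qed.

Lemma size_sum0 (V : nmodType) (f : nat -> V) : size_sum 0 f = f 0.
Proof.
rewrite /size_sum /packing_sum pyrene_chain0 fpowerset0 big_mkcond big_seq_fset1.
by rewrite cardfs0; case: disjoint_hexesP => // -[] c d v; rewrite in_fset0.
Qed.

Section Transfer.
Variable V : zmodType.
Implicit Types f : nat -> V.

(** The part of [size_sum] due to the sets that contain the last row hexagon
    [h_(2 n)]. *)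
Let last_sum n f : V :=
  packing_sum n (fun S => if (4 * n%:Z, 0) \in S then f #|` S|%fset else 0).

Let cardU1 H c (S : {fset lattice_point}) : c \notin H ->
  (S `<=` H)%fset -> #|` (c |` S)|%fset = #|` S|%fset.+1.
Proof.
move=> cP /fsubsetP SP; rewrite cardfsU1.
by case: (boolP (c \in S)) => // /SP; rewrite (negbTE cP).
Qed.

Let far n (c : lattice_point) : c \in pyrene_chain n -> c.1 <= 4 * n%:Z.
Proof. by case: c => x y /mem_pyrene_chain[] /andP[]. Qed.

Let size_sumS n f : size_sum n.+1 f =
  size_sum n f + size_sum n (fun k => f k.+1) *+ 4 + size_sum n (fun k => f k.+2)
  - last_sum n (fun k => f k.+1).
Proof.
rewrite /size_sum packing_sumS -!sumrMnl -!big_split -sumrB /=.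
apply: eq_packing_sum => S SP.
have nS c : 4 * n%:Z < c.1 -> c \notin pyrene_chain n.
  by move=> cx; apply/negP => /far; rewrite leNgt cx.
have nb : (4 * n%:Z + 3, - 3) \notin
    ((4 * n%:Z + 3, 3)%R |` pyrene_chain n)%fset.
  rewrite in_fset1U; apply/norP; split; first by rewrite xpair_eqE; lia.
  by apply: nS => /=; lia.
rewrite (cardU1 nb (fsetUS _ SP)).
rewrite !(cardU1 _ SP); [|by apply: nS => /=; lia..].
set x := f _; set y := f _; set z := f _.
have -> : y *+ 4 = y + y + y + y by rewrite !mulrSr mulr0n add0r.
case: ifP => _; rewrite ?addr0 ?subr0; last by rewrite [RHS](AC (1*4*1) (1*2*3*6*4*5)).
by apply/esym/eqP; rewrite subr_eq; apply/eqP; rewrite [LHS](AC (1*4*1) (1*2*3*6*4*5)).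
Qed.

(** A set containing [h_(2 n + 2)] contains no other hexagon of its unit, and the
    rest is an arbitrary disjoint set of the chain of length [n]. *)
Let last_sumS n f : last_sum n.+1 f = size_sum n (fun k => f k.+1).
Proof.
have e1 : (4 * n%:Z + 4 == 4 * n%:Z + 3) = false by lia.
have e2 : (4 * n%:Z + 4 == 4 * n%:Z + 2) = false by lia.
rewrite /last_sum packing_sumS; apply: eq_packing_sum => S SP.
have nS : (4 * n%:Z + 4, 0) \notin pyrene_chain n.
  by apply/negP => /far /=; rewrite gerDl.
have -> : 4 * n.+1%:Z = 4 * n%:Z + 4 by lia.
have nS' : ((4 * n%:Z + 4, 0) \in S) = false.
  by apply/negP => /(fsubsetP SP); rewrite (negbTE nS).
rewrite !in_fset1U nS' eqxx (cardU1 nS SP) !xpair_eqE.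
rewrite !e1 e2 /=.
by rewrite !add0r; case: ifP => _; rewrite addr0.
Qed.

Lemma size_sum1 f : size_sum 1 f = f 0%N + f 1%N *+ 4 + f 2%N.
Proof.
rewrite size_sumS !size_sum0 /last_sum /packing_sum pyrene_chain0 fpowerset0.
by rewrite big_mkcond big_seq_fset1 in_fset0 if_same subr0.
Qed.

(** Dual form of [P_(n+2) = (x ^ 2 + 4 x + 1) P_(n+1) - x ^ 2 P_n]. *)
Lemma size_sumSS n f : size_sum n.+2 f =
  size_sum n.+1 f + size_sum n.+1 (fun k => f k.+1) *+ 4
  + size_sum n.+1 (fun k => f k.+2) - size_sum n (fun k => f k.+2).
Proof. by rewrite size_sumS last_sumS. Qed.

End Transfer.

(** Disjoint sets have at most [2 n] elements, read off from the recurrence. *)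
Lemma size_sum_eq0 (V : zmodType) n (f : nat -> V) :
  (forall k, (k <= n * 2)%N -> f k = 0) -> size_sum n f = 0.
Proof.
suff : (forall f : nat -> V, (forall k, (k <= n * 2)%N -> f k = 0) ->
          size_sum n f = 0) /\
       (forall f : nat -> V, (forall k, (k <= n.+1 * 2)%N -> f k = 0) ->
          size_sum n.+1 f = 0) by case=> h _; apply: h.
elim: n {f} => [|n [IH0 IH1]]; split=> f f0.
- by rewrite size_sum0 f0.
- by rewrite size_sum1 !f0 // mul0rn !addr0.
- exact: IH1.
- rewrite size_sumSS !IH1 ?IH0 ?mul0rn ?addr0 ?subr0 // => k kn; apply: f0; lia.
Qed.

Lemma resonant_patternE n (S : {fset lattice_point}) : (S `<=` pyrene_chain n)%fset ->
  `[< resonant_pattern (pyrene_chain n) S >] = disjoint_hexes S.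
Proof.
move=> SP; apply/asboolP/idP => [/resonant_disjoint[]//|].
exact: pyrene_resonant.
Qed.

(** Over an arbitrary ring, so that the same identity serves integer
    polynomials and real probabilities. *)
Lemma sextet_number_size_sum (V : pzRingType) n k :
  (sextet_number (pyrene_chain n) k)%:R = size_sum n (fun j => (j == k)%:R) :> V.
Proof.
rewrite /sextet_number -sum1_size natr_sum big_fset /= /size_sum /packing_sum.
rewrite big_mkcond [RHS]big_mkcond [LHS]big_seq [RHS]big_seq.
apply: eq_bigr => S; rewrite fpowersetE => SP; rewrite resonant_patternE //.
by case: disjoint_hexes => //=; case: eqP.
Qed.

Lemma size_sum_sum (V : nmodType) (I : Type) (r : seq I) n (F : I -> nat -> V) :
  size_sum n (fun j => \sum_(i <- r) F i j) = \sum_(i <- r) size_sum n (F i).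
Proof. by rewrite /size_sum /packing_sum exchange_big. Qed.

Lemma sextet_sumE (V : pzRingType) n (f : nat -> V) :
  \sum_(0 <= k < (2 * n).+1) f k * (sextet_number (pyrene_chain n) k)%:R =
  size_sum n f.
Proof.
under eq_bigr do rewrite sextet_number_size_sum -size_sumZ.
rewrite -size_sum_sum; apply/eqP; rewrite -subr_eq0; apply/eqP.
rewrite /size_sum /packing_sum -sumrB.
apply: (@size_sum_eq0 _ n (fun j => \sum_(0 <= k < (2 * n).+1) f k * (j == k)%:R - f j)).
move=> j jn; rewrite (bigD1_seq j) ?iota_uniq ?mem_index_iota //=; last by lia.
rewrite eqxx mulr1 big1 ?addr0 ?subrr // => k kj.
by rewrite eq_sym (negbTE kj) mulr0.
Qed.

Lemma sextet_number_eq0 n k : (2 * n < k)%N -> sextet_number (pyrene_chain n) k = 0%N.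
Proof.
move=> nk; apply/eqP; rewrite -(eqr_nat int) sextet_number_size_sum.
by rewrite size_sum_eq0 // => j jn; case: eqVneq => // jk; lia.
Qed.

(** The Clar number and [2 n] both bound the sizes of resonant patterns, and the
    coefficients beyond either bound vanish, so both sums extend to a common
    range. *)
Lemma sextet_poly_pyrene n :
  sextet_poly (pyrene_chain n) =
  \sum_(k < (2 * n).+1) (sextet_number (pyrene_chain n) k)%:R *: 'X^k.
Proof.
set H := pyrene_chain n.
have clar k : (clar_number H < k)%N -> sextet_number H k = 0%N.
  move=> Hk; apply/eqP; rewrite cardfs_eq0; apply/eqP/fsetP => S.
  rewrite in_fset0; apply/negP; rewrite !inE /= => /and3P[SH Sr /eqP Sk].
  suff : (#|` S|%fset <= clar_number H)%N by rewrite Sk leqNgt Hk.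
  exact: leq_bigmax_seq.
pose N := maxn (clar_number H).+1 (2 * n).+1.
have widen m : (m <= N)%N -> (forall k, (m <= k)%N -> sextet_number H k = 0%N) ->
    \sum_(k < m) (sextet_number H k)%:R *: 'X^k =
    \sum_(k < N) (sextet_number H k)%:R *: 'X^k :> {poly int}.
  move=> mN z; rewrite -!(big_mkord xpredT (fun k => (sextet_number H k)%:R *: 'X^k)).
  rewrite (big_cat_nat _ mN) //= [X in _ = _ + X]big_nat_cond.
  by rewrite [X in _ = _ + X]big1 ?addr0 // => k /andP[/andP[mk _] _]; rewrite z // scale0r.
rewrite /sextet_poly (widen _ _ clar); last exact: leq_maxl.
by rewrite (widen _ _ (@sextet_number_eq0 n)) // leq_maxr.
Qed.

(** * Sums over the rows and Chebyshev polynomials *)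

Section Rows.
Variable R : realType.

Lemma fsum_int_support (G : int -> R) (N : nat) :
  (forall k, ~~ (0 <= k <= N%:Z) -> G k = 0) ->
  \sum_(k \in [set: int]) G k = \sum_(0 <= k < N.+1) G k%:Z.
Proof.
move=> G0; rewrite (@fsbigE _ _ _ _ _ [seq Posz k | k <- index_iota 0 N.+1]) //.
- rewrite big_map; apply: eq_bigl => k; exact: mem_setT.
- by rewrite map_inj_uniq ?iota_uniq // => a b [].
move=> k _ kN; apply: G0; apply: contra kN => /andP[k0 kN].
by apply/mapP; exists `|k|%N; rewrite ?mem_index_iota; lia.
Qed.

Lemma pyrene_fsum n (G : int -> R) :
  \sum_(k \in [set: int]) G k * pyrene_sextet R n k = size_sum n (fun k => G k%:Z).
Proof.
rewrite (@fsum_int_support _ (2 * n)); last first.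
  by move=> k kn; rewrite /pyrene_sextet (negbTE kn) mulr0.
rewrite -sextet_sumE big_nat [RHS]big_nat; apply: eq_bigr => k kn.
by rewrite /pyrene_sextet ifT.
Qed.

Definition centered_sum n (f : R -> R) : R := size_sum n (fun k => f (k%:R - n%:R)).

Lemma centered_sum0 f : centered_sum 0 f = f 0.
Proof. by rewrite /centered_sum size_sum0 subrr. Qed.

Lemma centered_sum1 f : centered_sum 1 f = f (- 1) + f 0 *+ 4 + f 1.
Proof. by rewrite /centered_sum size_sum1 sub0r subrr; congr (_ + _ + f _); ring. Qed.

(** In the centred variable the recurrence becomes symmetric under [m |-> - m].  It
    acts on exponentials, cosines and polynomials of low degree by explicit
    factors. *)
Lemma centered_sumSS n f : centered_sum n.+2 f =
  centered_sum n.+1 (fun m => f (m - 1) + 4 * f m + f (m + 1)) - centered_sum n f.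
Proof.
rewrite /centered_sum size_sumSS /= !size_sumD size_sumZ -[_ *+ 4]mulr_natl.
by congr (_ + _ * _ + _ - _); apply: eq_size_sum => k; congr f; ring.
Qed.

Lemma eq_centered_sum n f g : f =1 g -> centered_sum n f = centered_sum n g.
Proof. by move=> fg; apply: eq_size_sum => k; apply: fg. Qed.

Lemma centered_sumZ n a f : centered_sum n (fun m => a * f m) = a * centered_sum n f.
Proof. exact: size_sumZ. Qed.

Lemma centered_sumD n f g :
  centered_sum n (fun m => f m + g m) = centered_sum n f + centered_sum n g.
Proof. exact: size_sumD. Qed.

(** Chebyshev polynomials of the second kind. *)
Fixpoint chebU n (y : R) : R :=
  if n is m.+1 then if m is l.+1 then 2 * y * chebU m y - chebU l y else 2 * y else 1.

Lemma chebUSS n y : chebU n.+2 y = 2 * y * chebU n.+1 y - chebU n y.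
Proof. by []. Qed.

Lemma nat_two_step_ind (P : nat -> Prop) : P 0%N -> P 1%N ->
  (forall n, P n -> P n.+1 -> P n.+2) -> forall n, P n.
Proof.
move=> P0 P1 PS n; suff [] : P n /\ P n.+1 by [].
by elim: n => // n [] *; split; auto.
Qed.

(** [cos (m t + a)] is an eigenfunction of the symmetric second difference, with
    eigenvalue [2 (2 + cos t)].  The phase [a] makes the induction cover the
    cosine and sine transforms at once. *)
Lemma centered_sum_cos n t a :
  centered_sum n (fun m => cos (m * t + a)) = chebU n (2 + cos t) * cos a.
Proof.
elim/nat_two_step_ind: n => [||n IH0 IH1].
- by rewrite centered_sum0 mul0r add0r mul1r.
- by rewrite centered_sum1 mul0r add0r mulN1r mul1r !cosD cosN sinN /=; ring.
rewrite centered_sumSS IH0 chebUSS.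
rewrite (@eq_centered_sum _ _ (fun m => (2 * (2 + cos t)) * cos (m * t + a))).
  by rewrite centered_sumZ IH1; ring.
move=> m; have -> : (m - 1) * t + a = (m * t + a) - t by ring.
have -> : (m + 1) * t + a = (m * t + a) + t by ring.
by move: (m * t + a) => w; rewrite cosB cosD; ring.
Qed.

Lemma centered_sum_const n : centered_sum n (fun=> 1) = chebU n 3.
Proof.
have -> : 3 = 2 + cos 0 :> R by rewrite cos0; ring.
rewrite -[RHS]mulr1 -[in X in _ * X](@cos0 R) -centered_sum_cos.
by apply: eq_centered_sum => m; rewrite mulr0 addr0 cos0.
Qed.

Lemma centered_sum_id n : centered_sum n id = 0.
Proof.
elim/nat_two_step_ind: n => [||n IH0 IH1].
- by rewrite centered_sum0.
- by rewrite centered_sum1; ring.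
rewrite centered_sumSS IH0 (@eq_centered_sum _ _ (fun m => 6 * m)).
  by rewrite centered_sumZ IH1; ring.
by move=> m /=; ring.
Qed.

Lemma centered_sum_sqrSS n : centered_sum n.+2 (fun m => m ^+ 2) =
  6 * centered_sum n.+1 (fun m => m ^+ 2) + 2 * chebU n.+1 3
  - centered_sum n (fun m => m ^+ 2).
Proof.
rewrite centered_sumSS -centered_sum_const -!centered_sumZ -centered_sumD.
by congr (_ - _); apply: eq_centered_sum => m; ring.
Qed.

End Rows.

(** * Closed forms, decay and second moments *)

Section Chebyshev.
Variable R : realType.
Implicit Types (n : nat) (y l : R).

Lemma chebU_incr n y : 1 <= y -> 1 <= chebU n y <= chebU n.+1 y.
Proof.
move=> y1; elim: n => [|n /andP[U1 UU]]; first by rewrite lexx /=; nra.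
rewrite (le_trans U1 UU) chebUSS; nra.
Qed.

Lemma chebU_gt0 n y : 1 <= y -> 0 < chebU n y.
Proof. by move=> /(chebU_incr n)/andP[+ _]; apply: lt_le_trans. Qed.

(** The quotient [U_(n+1) / (y U_n)] is nondecreasing in [y] because the
    recurrence reads [U_(n+2) / (y U_(n+1)) = 2 - U_n / (y U_(n+1))], where
    [y U_(n+1) / U_n] increases by induction.  This is the comparison with
    [y = 3], cleared of denominators. *)
Lemma chebU_ratio n y : 1 <= y <= 3 ->
  3 * (chebU n.+1 y * chebU n 3) <= y * (chebU n.+1 3 * chebU n y).
Proof.
move=> /andP[y1 y3]; elim: n => [|n IH]; first by rewrite /=; nra.
have [a0 a1] := (chebU_gt0 n y1, chebU_gt0 n.+1 y1).
have z1 : 1 <= 3 :> R by rewrite ler1n.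
have [b0 b1] := (chebU_gt0 n z1, chebU_gt0 n.+1 z1).
rewrite !chebUSS; move: a0 a1 b0 b1 IH.
move: (chebU n y) (chebU n.+1 y) (chebU n 3) (chebU n.+1 3) => a a' b b'.
move=> a0 a1 b0 b1 IH.
have ab : 0 < a * b' by rewrite mulr_gt0.
have h : y * (b * a') <= 3 * (a * b').
  have : y * (3 * (a' * b)) <= y * (y * (b' * a)) by rewrite ler_wpM2l //; lra.
  have : 0 <= (9 - y * y) * (a * b') by rewrite mulr_ge0 ?(ltW ab) //; nra.
  nra.
nra.
Qed.

(** Gives an exponential decay in [n] of the characteristic functions away from
    the origin, uniformly in [y]. *)
Lemma chebU_decay n y : 1 <= y <= 3 -> chebU n y / chebU n 3 <= (y / 3) ^+ n.
Proof.
move=> y13; have /andP[y1 y3] := y13; have z1 : 1 <= 3 :> R by rewrite ler1n.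
elim: n => [|n IH]; first by rewrite expr0 divr1.
rewrite exprS; apply: le_trans (ler_wpM2l _ IH); last by apply: divr_ge0; lra.
rewrite ler_pdivrMr ?chebU_gt0 // -(ler_pM2r (chebU_gt0 n z1)) -(ler_pM2l (ltr0n R 3)).
have := chebU_ratio n y13; congr (_ <= _).
by field; rewrite gt_eqF // chebU_gt0.
Qed.

Lemma chebU_closed n y l : l != 0 -> l + l^-1 = 2 * y ->
  chebU n y * (l - l^-1) = l ^+ n.+1 - l^-1 ^+ n.+1.
Proof.
move=> l0 ly; elim/nat_two_step_ind: n => [||n IH0 IH1].
- by rewrite !expr1 mul1r.
- by rewrite /= -ly; ring.
rewrite chebUSS mulrBl -[_ * chebU _ _ * _]mulrA IH1 IH0 -ly !exprS.
have := mulfV l0; move: (l ^+ n) (l^-1) => a k lk; move: (k ^+ n) => b.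
have -> : (l + k) * (l * (l * a) - k * (k * b)) =
  l * (l * (l * a)) + (l * k) * (l * a) - (l * k) * (k * b) - k * (k * (k * b)) by ring.
by rewrite lk; ring.
Qed.

(** The larger root of [l + 1 / l = 2 y]. *)
Definition chebU_root y : R := y + Num.sqrt (y ^+ 2 - 1).

Lemma chebU_root_ge y : 1 <= y -> y <= chebU_root y.
Proof. by move=> y1; rewrite lerDl sqrtr_ge0. Qed.

Lemma chebU_root_gt0 y : 1 <= y -> 0 < chebU_root y.
Proof. by move=> y1; apply: lt_le_trans (chebU_root_ge y1); lra. Qed.

Lemma chebU_rootV y : 1 <= y -> (chebU_root y)^-1 = y - Num.sqrt (y ^+ 2 - 1).
Proof.
move=> y1; have l0 := chebU_root_gt0 y1; apply: (mulfI (lt0r_neq0 l0)).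
rewrite mulfV ?gt_eqF // /chebU_root [RHS]mulrC -subr_sqr sqr_sqrtr; first by ring.
by rewrite subr_ge0 expr_ge1 //; lra.
Qed.

Lemma chebU_rootDV y : 1 <= y -> chebU_root y + (chebU_root y)^-1 = 2 * y.
Proof. by move=> y1; rewrite chebU_rootV // /chebU_root; ring. Qed.

Lemma chebU_root3BV : chebU_root 3 - (chebU_root 3)^-1 = 4 * Num.sqrt 2.
Proof.
rewrite chebU_rootV ?ler1n // /chebU_root; have -> : 3 ^+ 2 - 1 = 2 ^+ 2 * 2 :> R by ring.
by rewrite sqrtrM ?sqr_ge0 // sqrtr_sqr ger0_norm //; ring.
Qed.

(** The second moment is the derivative at [3] of [U_n]; differentiating the
    closed form of [U_n] yields this formula, and both sides satisfy the recurrence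
    of [centered_sum_sqrSS]. *)
Lemma second_moment n : 16 * centered_sum n (fun m => m ^+ 2) =
  n.+1%:R * (chebU_root 3 ^+ n.+1 + (chebU_root 3)^-1 ^+ n.+1) - 6 * chebU n (3 : R).
Proof.
have l6 := @chebU_rootDV 3 (ler1n _ _); have l0 := lt0r_neq0 (@chebU_root_gt0 3 (ler1n _ _)).
have := mulfV l0; move: (chebU_root 3) ((chebU_root 3)^-1) l6 => l k lk6 lk.
have kE : k = 6 - l by lra.
have l2 : l ^+ 2 = 6 * l - 1 by move: lk; rewrite kE; nra.
have k2 : k ^+ 2 = 6 * k - 1 by move: lk; rewrite kE; nra.
pose C m : R := l ^+ m + k ^+ m.
have CS m : C m.+2 = 6 * C m.+1 - C m.
  rewrite /C; have eS (x : R) : x ^+ 2 = 6 * x - 1 -> x ^+ m.+2 = 6 * x ^+ m.+1 - x ^+ m.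
    by move=> x2; rewrite -addn2 exprD x2 exprS; ring.
  by rewrite !eS //; ring.
have C0 : C 0%N = 2 by rewrite /C !expr0.
have C1 : C 1%N = 6 by rewrite /C !expr1; lra.
have CU m : 3 * C m.+1 - C m = 16 * chebU m 3.
  elim/nat_two_step_ind: m => [||m IH0 IH1].
  - by rewrite C0 C1 /=; ring.
  - by rewrite CS C0 C1 /=; ring.
  rewrite chebUSS; have := CS m.+1; have := CS m; lra.
rewrite -/(C n.+1); elim/nat_two_step_ind: n => [||n IH0 IH1].
- by rewrite centered_sum0 C1 /=; ring.
- by rewrite centered_sum1 CS C0 C1 /=; ring.
rewrite centered_sum_sqrSS.
have -> : 16 * (6 * centered_sum n.+1 (fun m => m ^+ 2) + 2 * chebU n.+1 3 -
    centered_sum n (fun m => m ^+ 2)) =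
  6 * (16 * centered_sum n.+1 (fun m => m ^+ 2)) + 32 * chebU n.+1 3 -
    16 * centered_sum n (fun m => m ^+ 2) :> R by ring.
rewrite IH0 IH1 chebUSS (CS n.+1).
have -> : n.+3%:R = n.+1%:R + 2 :> R by ring.
have -> : n.+2%:R = n.+1%:R + 1 :> R by ring.
have -> : chebU n.+1 3 = (3 * C n.+2 - C n.+1) / 16 by rewrite CU; field.
by field.
Qed.

End Chebyshev.

(** * Mean and variance *)

Section Moments.
Variable R : realType.
Local Notation a := (@pyrene_sextet R).

Lemma pyrene_total n : \sum_(j \in [set: int]) a n j = chebU n 3.
Proof.
rewrite -centered_sum_const.
transitivity (\sum_(j \in [set: int]) (fun=> 1) j * a n j); last exact: pyrene_fsum.
by apply: eq_fsbigr => j _; rewrite mul1r.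
Qed.

Lemma chebU3_neq0 n : chebU n (3 : R) != 0.
Proof. by rewrite gt_eqF // chebU_gt0 // ler1n. Qed.

Lemma row_prob_fsum n (G : int -> R) :
  \sum_(k \in [set: int]) G k * row_prob a n k =
  size_sum n (fun k => G k%:Z) / chebU n 3.
Proof.
rewrite -pyrene_fsum mulr_fsuml; apply: eq_fsbigr => k _.
by rewrite /row_prob pyrene_total mulrA.
Qed.

Lemma pyrene_mean n : row_mean a n = n%:R.
Proof.
rewrite /row_mean row_prob_fsum.
have -> : size_sum n (fun k : nat => k%:~R) =
    centered_sum n id + n%:R * centered_sum n (fun=> 1) :> R.
  rewrite -centered_sumZ -centered_sumD; apply: eq_size_sum => k.
  by rewrite mulr1 subrK.
by rewrite centered_sum_id add0r centered_sum_const mulfK // chebU3_neq0.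
Qed.

Lemma pyrene_variance n :
  row_variance a n = centered_sum n (fun m => m ^+ 2) / chebU n 3.
Proof. by rewrite /row_variance pyrene_mean row_prob_fsum. Qed.

Local Notation s2 := (Num.sqrt (2 : R)).

Lemma sqrt2_gt0 : 0 < s2. Proof. by rewrite sqrtr_gt0. Qed.

Lemma sqrt2_sqr : s2 ^+ 2 = 2. Proof. by rewrite sqr_sqrtr. Qed.

Lemma chebU_root3_gt1 : 1 < chebU_root (3 : R).
Proof. by apply: lt_le_trans (@chebU_root_ge _ 3 _); rewrite ?ltr1n ?ler1n. Qed.

Lemma chebU_root3V_lt1 : 0 < (chebU_root (3 : R))^-1 < 1.
Proof.
have l0 : 0 < chebU_root (3 : R) by apply: lt_trans chebU_root3_gt1.
by rewrite invr_gt0 l0 invf_lt1 // chebU_root3_gt1.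
Qed.

Lemma chebU_rootE n y : 1 < y -> chebU n (y : R) =
  chebU_root y ^+ n.+1 * (1 - ((chebU_root y)^-1 ^+ 2) ^+ n.+1) / (chebU_root y - (chebU_root y)^-1).
Proof.
move=> y1; have l0 := chebU_root_gt0 (ltW y1).
have l1 : 1 < chebU_root y by apply: lt_le_trans (chebU_root_ge (ltW y1)).
have lk : (chebU_root y)^-1 < 1 by rewrite invf_lt1.
apply: (mulIf (x := chebU_root y - (chebU_root y)^-1)); first by rewrite gt_eqF //; lra.
rewrite divfK; last by rewrite gt_eqF //; lra.
rewrite (chebU_closed _ (lt0r_neq0 l0) (chebU_rootDV (ltW y1))) mulrBr mulr1 -exprMn.
by rewrite expr2 mulrA mulfV ?lt0r_neq0 // mul1r.
Qed.

(** By the closed forms the quotient is [(4 sqrt 2 coth - 6 / (n + 1)) / 16], where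
    the hyperbolic cotangent is taken at a multiple of [n + 1] and tends to [1].
    Dividing by [n + 1] instead of [n] keeps the denominator nonzero. *)
Lemma row_variance_limit :
  row_variance a n / n.+1%:R @[n --> \oo] --> s2 / 4.
Proof.
set q := (chebU_root (3 : R))^-1 ^+ 2.
have /andP[k0 k1] := chebU_root3V_lt1.
have q01 : 0 < q < 1 by rewrite exprn_gt0 // exprn_ilt1 // ltW.
have s0 := sqrt2_gt0.
have q0 : q ^+ n.+1 @[n --> \oo] --> (0 : R).
  have := @cvg_expr R q; rewrite ger0_norm; last by lra.
  by move=> /(_ _) h; rewrite (cvg_shiftS (fun n => q ^+ n)); apply: h; lra.
have E n : row_variance a n / n.+1%:R =
    (4 * s2 * ((1 + q ^+ n.+1) / (1 - q ^+ n.+1)) - 6 * harmonic n) / 16.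
  rewrite pyrene_variance.
  have -> : centered_sum n (fun m => m ^+ 2) = 16 * centered_sum n (fun m => m ^+ 2) / 16 :> R.
    by field.
  rewrite second_moment.
  have U0 := chebU3_neq0 n.
  have n0 : n.+1%:R != 0 :> R by rewrite pnatr_eq0.
  have q1 : 1 - q ^+ n.+1 != 0.
    by rewrite gt_eqF // subr_gt0 exprn_ilt1 //; lra.
  have -> : chebU_root 3 ^+ n.+1 + (chebU_root 3)^-1 ^+ n.+1 =
     4 * s2 * ((1 + q ^+ n.+1) / (1 - q ^+ n.+1)) * chebU n 3.
    rewrite chebU_rootE ?ltr1n // -/q chebU_root3BV.
    have -> : (chebU_root 3)^-1 ^+ n.+1 = chebU_root 3 ^+ n.+1 * q ^+ n.+1 :> R.
      rewrite -exprMn /q expr2 mulrA mulfV ?mul1r //.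
      by rewrite gt_eqF // (lt_trans _ chebU_root3_gt1).
    by field; rewrite q1 andbT gt_eqF.
  rewrite /harmonic /=; move: U0 n0 q1.
  move: (chebU n 3) (n.+1%:R : R) (q ^+ n.+1) => U N r U0 N0 r1.
  by field; rewrite U0 N0 r1.
under eq_cvg do rewrite E.
have -> : s2 / 4 = (4 * s2 * ((1 + 0) / (1 - 0)) - 6 * 0) / 16 by field.
apply: cvgMl; apply: cvgB; last by apply: cvgMr; exact: cvg_harmonic.
apply: cvgMr; apply: cvgM; first by apply: cvgD q0; exact: cvg_cst.
apply: cvgV; first by rewrite subr0 oner_neq0.
by apply: cvgB q0; exact: cvg_cst.
Qed.

End Moments.

(** * The limit of the characteristic functions *)

Section CharacteristicFunction.
Variable R : realType.
Local Notation a := (@pyrene_sextet R).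
Local Notation s2 := (Num.sqrt (2 : R)).

(** The characteristic function of the centred distribution; it is real, the
    distribution being symmetric. *)
Definition charf n (t : R) : R := chebU n (2 + cos t) / chebU n 3.

Lemma row_variance_ge0 n : 0 <= row_variance a n.
Proof.
rewrite pyrene_variance divr_ge0 //; last by rewrite ltW // chebU_gt0 // ler1n.
by apply: sumr_ge0 => S _; apply: sqr_ge0.
Qed.

Lemma row_sd_sqr n : row_sd a n ^+ 2 = row_variance a n.
Proof. by rewrite sqr_sqrtr // row_variance_ge0. Qed.

Lemma cvg_sqrtr (T : Type) (F : set_system T) (FF : Filter F) (f : T -> R) (l : R) :
  f x @[x --> F] --> l -> Num.sqrt (f x) @[x --> F] --> Num.sqrt l.
Proof. by move=> fl; apply: continuous_cvg => //; apply: sqrt_continuous. Qed.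

Lemma invn_variance_limit :
  n.+1%:R / row_variance a n @[n --> \oo] --> 2 * s2.
Proof.
have s0 := sqrt2_gt0 R.
have -> : 2 * s2 = (s2 / 4)^-1.
  rewrite invf_div; apply: (mulIf (lt0r_neq0 s0)); rewrite divfK ?gt_eqF //.
  by rewrite -mulrA -expr2 sqrt2_sqr -natrM.
under eq_cvg do rewrite -invf_div.
apply: cvgV; last exact: row_variance_limit.
by rewrite gt_eqF // divr_gt0.
Qed.

Lemma row_sd_inv_limit : (row_sd a n)^-1 @[n --> \oo] --> (0 : R).
Proof.
have h : Num.sqrt (n.+1%:R / row_variance a n * harmonic n) @[n --> \oo] --> (0 : R).
  rewrite -[in X in _ --> X](@sqrtr0 R); apply: cvg_sqrtr.
  rewrite -[X in _ --> X](mulr0 (2 * s2)).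
  by apply: cvgM; [exact: invn_variance_limit|exact: cvg_harmonic].
apply: cvg_trans h; apply: near_eq_cvg; near=> n.
rewrite /row_sd -sqrtrV ?row_variance_ge0 //; congr Num.sqrt.
by rewrite /harmonic /= mulrAC mulfV ?pnatr_eq0 // mul1r.
Unshelve. all: by end_near. Qed.

Lemma cos_half (x : R) : cos x = 1 - 2 * sin (x / 2) ^+ 2.
Proof.
have -> : cos x = cos (x / 2 *+ 2) by congr cos; rewrite -mulr_natr divfK.
by rewrite cos_mulr2n cos2sin2; ring.
Qed.

(** With [l = chebU_root y] and [y = 2 + cos t], the closed form shows that the
    characteristic function is asymptotic to [(l / l_3) ^ (n + 1)], where
    [l_3 = chebU_root 3].  Both logarithm and sine are replaced by their linear
    parts, with a factor that is continuous at the base point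
    ([is_derive1_caratheodory]); this also covers indices at which the increment
    is zero.  The identity [(l - l_3) (1 - 1 / (l l_3)) = 2 (y - 3)] gives the
    derivative of [l] without differentiating a square root. *)
Lemma charf_limit u :
  charf n (u / row_sd a n) @[n --> \oo] --> expR (- (u ^+ 2 / 2)).
Proof.
have s0 := sqrt2_gt0 R.
have [->|u0] := eqVneq u 0.
  have -> : (fun n => charf n (0 / row_sd a n)) = fun=> 1.
    apply/funext => n; rewrite mul0r /charf cos0.
    by rewrite (_ : 2 + 1 = 3) ?divff ?chebU3_neq0 //; ring.
  by rewrite expr0n mul0r oppr0 expR0; apply: cvg_cst.
pose t n := u / row_sd a n; pose y n := 2 + cos (t n).
have t0 : t n @[n --> \oo] --> (0 : R).
  by rewrite -[X in _ --> X](mulr0 u); apply: cvgMr; exact: row_sd_inv_limit.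
have y3 : y n @[n --> \oo] --> (3 : R).
  have -> : 3 = 2 + cos 0 :> R by rewrite cos0; ring.
  apply: cvgD; first exact: cvg_cst.
  by apply: continuous_cvg => //; apply: continuous_cos.
have l3 : chebU_root (y n) @[n --> \oo] --> chebU_root (3 : R).
  apply: (cvgD y3); apply: cvg_sqrtr; apply: cvgB; last exact: cvg_cst.
  exact: (cvgM y3 y3).
have l0 : chebU_root (3 : R) != 0 by rewrite gt_eqF // (lt_trans _ (chebU_root3_gt1 R)).
have lV : (chebU_root (y n))^-1 @[n --> \oo] --> (chebU_root (3 : R))^-1 by apply: cvgV.
have /is_derive1_caratheodory[g [gE gc g0]] := is_derive_sin (0 : R).
have cos_lim : n.+1%:R * (y n - 3) @[n --> \oo] --> - s2 * u ^+ 2.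
  have E n : n.+1%:R * (y n - 3) =
     - (u ^+ 2 / 2) * (n.+1%:R / row_variance a n) * (g (t n / 2)) ^+ 2.
    have := gE (t n / 2); rewrite sin0 !subr0 => gs.
    have -> : y n - 3 = - (2 * sin (t n / 2) ^+ 2).
      by rewrite /y cos_half; ring.
    rewrite gs -row_sd_sqr exprMn /t.
    rewrite -exprVn; move: ((row_sd a n)^-1) => w; move: (g (u * w / 2)) => z; by field.
  under eq_cvg do rewrite E.
  have -> : - s2 * u ^+ 2 = - (u ^+ 2 / 2) * (2 * s2) * 1 ^+ 2 by field.
  (* [cos t - 1 = - 2 sin (t / 2) ^ 2] and [sin z = g z * z] with [g] tending to 1 *)
  have gl : g (t n / 2) @[n --> \oo] --> (1 : R).
    have g01 : g 0 = 1 by rewrite g0 cos0.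
    rewrite -[X in _ --> X]g01; apply: continuous_cvg => //.
    by rewrite -[X in _ --> X](mul0r 2^-1); apply: cvgM => //; exact: cvg_cst.
  apply: cvgM; first by apply: cvgMr; exact: invn_variance_limit.
  exact: (cvgM gl gl).
have ln_lim : n.+1%:R * ln (chebU_root (y n) / chebU_root 3) @[n --> \oo] --> - (u ^+ 2 / 2).
  have /is_derive1_caratheodory[h [hE hc h1]] := is_derive1_ln (ltr01 : 0 < 1 :> R).
  have r1 : chebU_root (y n) / chebU_root 3 @[n --> \oo] --> (1 : R).
    by rewrite -[X in _ --> X](mulfV l0); apply: cvgM => //; exact: cvg_cst.
  have E : \forall n \near \oo, h (chebU_root (y n) / chebU_root 3) *
        (n.+1%:R * (y n - 3)) * (2 / (chebU_root 3 - (chebU_root (y n))^-1)) =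
        n.+1%:R * ln (chebU_root (y n) / chebU_root 3).
    near=> n.
    have y1 : 1 <= y n by near: n; apply: (cvgr_ge _ y3); rewrite ltr1n.
    have := hE (chebU_root (y n) / chebU_root 3); rewrite ln1 subr0 => ->.
    have kl : (chebU_root (y n))^-1 < chebU_root 3.
      apply: le_lt_trans (chebU_root3_gt1 R).
      by rewrite invf_le1 ?chebU_root_gt0 // (le_trans y1) // chebU_root_ge.
    have l1 := lt0r_neq0 (chebU_root_gt0 y1).
    have yE : y n = (chebU_root (y n) + (chebU_root (y n))^-1) / 2 by rewrite chebU_rootDV //; field.
    have E3 : 3 = (chebU_root 3 + (chebU_root 3)^-1) / 2 :> R by rewrite chebU_rootDV ?ler1n //; field.
    have -> : chebU_root (y n) / chebU_root 3 - 1 = (y n - 3) * (2 / (chebU_root 3 - (chebU_root (y n))^-1)).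
      rewrite {2}yE {2}E3; move: l1 kl l0.
      move: (chebU_root (y n)) (chebU_root 3) => l' l l1 kl l0.
      have d : l * l' - 1 != 0.
        apply: contraTneq kl => /eqP; rewrite subr_eq0 => /eqP d.
        by rewrite -[l'^-1]mul1r -d mulfK // ltxx.
      by field; rewrite l1 l0 d.
    by ring.
  apply: cvg_trans (near_eq_cvg E) _.
  have -> : - (u ^+ 2 / 2) = 1 * (- s2 * u ^+ 2) * (2 / (chebU_root 3 - (chebU_root 3)^-1)).
    by rewrite chebU_root3BV; field; rewrite gt_eqF.
  apply: cvgM; first apply: cvgM => //.
    rewrite -[X in _ --> X](invr1) -h1; exact: continuous_cvg.
  apply: cvgM; first exact: cvg_cst.
  apply: cvgV; first by rewrite chebU_root3BV gt_eqF // mulr_gt0.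
  by apply: cvgB => //; exact: cvg_cst.
have pow0 (c : nat -> R) : (\forall n \near \oo, 0 <= c n <= 2^-1) ->
    c n ^+ n.+1 @[n --> \oo] --> (0 : R).
  move=> c12.
  have half : (2^-1 : R) ^+ n.+1 @[n --> \oo] --> (0 : R).
    rewrite (cvg_shiftS (fun n => (2^-1 : R) ^+ n)); apply: cvg_expr.
    by rewrite ger0_norm // invf_lt1 // ltr1n.
  apply: squeeze_cvgr half; last exact: cvg_cst.
  near=> n; have /andP[c0 c1] : 0 <= c n <= 2^-1 by near: n.
  by rewrite exprn_ge0 //= lerXn2r // nnegrE.
have y2 : \forall n \near \oo, 2 <= y n by apply: (cvgr_ge _ y3); rewrite ltr_nat.
have half (z : R) : 2 <= z -> 0 <= (chebU_root z)^-1 ^+ 2 <= 2^-1.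
  move=> z2; have z1 : 1 <= z by lra.
  have lz := chebU_root_ge z1; have l0' := chebU_root_gt0 z1.
  have : 0 <= (chebU_root z)^-1 <= 2^-1.
    by rewrite invr_ge0 (ltW l0') lef_pV2 ?posrE //; lra.
  by move: (chebU_root z)^-1 => k; nra.
have E : \forall n \near \oo,
    expR (n.+1%:R * ln (chebU_root (y n) / chebU_root 3)) *
    ((1 - ((chebU_root (y n))^-1 ^+ 2) ^+ n.+1) / (1 - ((chebU_root 3)^-1 ^+ 2) ^+ n.+1)) *
    (4 * s2 / (chebU_root (y n) - (chebU_root (y n))^-1)) = charf n (u / row_sd a n).
  near=> n.
  have y2n : 2 <= y n by near: n.
  rewrite /charf -/(t n) -/(y n) !chebU_rootE ?ltr1n //; last by lra.
  have l1 : 0 < chebU_root (y n) by apply: chebU_root_gt0; lra.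
  have l2 : 0 < chebU_root (3 : R) by apply: chebU_root_gt0; rewrite ler1n.
  rewrite expRM_natl lnK ?posrE ?divr_gt0 // expr_div_n chebU_root3BV.
  have d1 : 1 - ((chebU_root 3)^-1 ^+ 2) ^+ n.+1 != 0 :> R.
    rewrite gt_eqF // subr_gt0 exprn_ilt1 ?sqr_ge0 //.
    have /andP[_] : 0 <= (chebU_root (3 : R))^-1 ^+ 2 <= 2^-1 by apply: half; rewrite ler_nat.
    by move=> h; apply: le_lt_trans h _; rewrite invf_lt1 // ltr1n.
  have d2 : chebU_root (y n) - (chebU_root (y n))^-1 != 0.
    have ly : 2 <= chebU_root (y n) by apply: (le_trans y2n); apply: chebU_root_ge; lra.
    have : (chebU_root (y n))^-1 < 1 by rewrite invf_lt1 //; lra.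
    by move=> ly'; rewrite gt_eqF // subr_gt0 (lt_le_trans ly') //; lra.
  have d3 : chebU_root 3 ^+ n.+1 != 0 :> R by rewrite expf_neq0.
  move: d1 d2 d3.
  move: (chebU_root (y n) - _) (1 - _) (1 - _) (chebU_root 3 ^+ n.+1) => A1 A2 A3 A4 d1 d2 d3.
  by field; rewrite d1 d2 d3 gt_eqF.
apply: cvg_trans (near_eq_cvg E) _.
have -> : expR (- (u ^+ 2 / 2)) = expR (- (u ^+ 2 / 2)) * ((1 - 0) / (1 - 0)) *
    (4 * s2 / (chebU_root 3 - (chebU_root 3)^-1)).
  by rewrite chebU_root3BV subr0 !divff ?mulr1 // gt_eqF // mulr_gt0.
apply: cvgM; first apply: cvgM.
- by apply: continuous_cvg => //; apply: continuous_expR.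
- apply: cvgM.
    apply: cvgB; first exact: cvg_cst.
    by apply: pow0; near=> n; apply: half; near: n.
  apply: cvgV; first by rewrite subr0.
  apply: cvgB; first exact: cvg_cst.
  by apply: pow0; near=> n; apply: half; rewrite ler_nat.
- apply: cvgM; first exact: cvg_cst.
  apply: cvgV; first by rewrite chebU_root3BV gt_eqF // mulr_gt0.
  exact: cvgB.
Unshelve. all: by end_near. Qed.

End CharacteristicFunction.

(** * Integrals of real functions and the Gaussian *)

Section RealIntegrals.
Context {R : realType}.
Local Notation mu := (@lebesgue_measure R).
Implicit Types f g F : R -> R.

Lemma Rintegral_FTC2 f F (u v : R) : u < v ->
  continuous f -> (forall x : R, is_derive x 1 F (f x)) ->
  \int[mu]_(x in `[u, v]) f x = F v - F u.
Proof.
move=> uv cf dF; have cF : continuous F.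
  move=> x; apply: differentiable_continuous; apply/derivable1_diffP.
  exact: (@ex_derive _ _ _ _ _ _ _ (dF x)).
rewrite /Rintegral (@continuous_FTC2 _ f F) //.
- exact: continuous_subspaceT.
- split=> [x _| |]; first exact: (@ex_derive _ _ _ _ _ _ _ (dF x)).
    by apply: cvg_at_right_filter; apply: cF.
  by apply: cvg_at_left_filter; apply: cF.
- by move=> x _; rewrite derive1E (@derive_val _ _ _ _ _ _ _ (dF x)).
Qed.

Lemma dominated_integrable_R f g : measurable_fun setT f ->
  mu.-integrable setT (EFin \o g) -> (forall x, `|f x| <= g x) ->
  mu.-integrable setT (EFin \o f).
Proof.
move=> mf ig fg; apply: (le_integrable measurableT _ _ ig).
  exact/measurable_EFinP.
by move=> x _ /=; rewrite lee_fin (le_trans (fg x)) // ler_norm.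
Qed.

Lemma dominated_cvg_R (h : nat -> R -> R) f g :
    (forall n, measurable_fun setT (h n)) ->
    mu.-integrable setT (EFin \o g) ->
    (forall n x, `|h n x| <= g x) ->
    (forall x, h n x @[n --> \oo] --> f x) ->
  [/\ mu.-integrable setT (EFin \o f),
      \int[mu]_x `|h n x - f x| @[n --> \oo] --> (0 : R) &
      \int[mu]_x h n x @[n --> \oo] --> \int[mu]_x f x].
Proof.
move=> mh ig hg hf.
have [|||||fi h0 hi] := @dominated_convergence _ _ _ mu _ measurableT
  (fun n => EFin \o h n) (EFin \o f) (EFin \o g).
- by move=> n; apply/measurable_EFinP; exact: mh.
- by apply/measurable_EFinP; apply: (measurable_fun_cvg mh) => x _; apply: hf.
- by apply: aeW => x _; apply/fine_cvgP; split; [exact: nearW|exact: hf].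
- by [].
- by apply: aeW => x n _; rewrite lee_fin.
split=> //.
- by move/fine_cvgP : h0 => [].
- have ffin : (\int[mu]_x (EFin \o f) x)%E \is a fin_num by apply: integrable_fin_num.
  by move: hi; rewrite -(fineK ffin) => /fine_cvgP[].
Qed.

Lemma cvg_Rintegral_itv f : mu.-integrable setT (EFin \o f) ->
  \int[mu]_(x in `[- n%:R, n%:R]) f x @[n --> \oo] --> \int[mu]_x f x.
Proof.
move=> fi; have mf : measurable_fun setT f.
  by apply/measurable_EFinP; apply: measurable_int fi.
under eq_cvg do rewrite Rintegral_mkcond.
have fai : mu.-integrable setT (EFin \o (fun x => `|f x|)).
  by have := integrable_norm fi.
case: (@dominated_cvg_R (fun n => f \_ `[- n%:R, n%:R]) f (fun x => `|f x|)) => //.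
- move=> n; apply/(measurable_restrictT _ _).1 => //.
  exact: measurable_funS mf.
- by move=> n x; rewrite patchE; case: ifP => // _; rewrite normr0.
- move=> x; apply/cvgrPdist_lt => e e0; near=> n.
  rewrite patchE ifT ?subrr ?normr0 //; apply/mem_set; rewrite /= in_itv /=.
  rewrite -ler_norml; near: n; exact: nbhs_infty_ger.
Unshelve. all: by end_near. Qed.

Lemma continuous_integrable_dominated f g : continuous f ->
  mu.-integrable setT (EFin \o g) -> (forall x, `|f x| <= g x) ->
  mu.-integrable setT (EFin \o f).
Proof.
by move=> cf; apply: dominated_integrable_R; apply: continuous_measurable_fun.
Qed.

Lemma gaussian_normal_pdf (c : R) : 0 < c -> forall x,
  expR (- (x ^+ 2 / c)) =
  Num.sqrt (c * pi) * normal_pdf 0 (Num.sqrt (c / 2)) x.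
Proof.
move=> c0 x; have s0 : Num.sqrt (c / 2) != 0 by rewrite gt_eqF // sqrtr_gt0 divr_gt0.
rewrite normal_pdfE // /normal_peak /normal_fun.
rewrite sqr_sqrtr; last by rewrite ltW // divr_gt0.
have -> : c / 2 * pi *+ 2 = c * pi by rewrite -mulr_natr; field.
rewrite mulrA mulfV ?mul1r ?gt_eqF ?sqrtr_gt0 ?mulr_gt0 ?pi_gt0 //.
by congr expR; rewrite subr0 -mulr_natr; field; rewrite gt_eqF.
Qed.

Lemma integrable_gaussian (c : R) : 0 < c ->
  mu.-integrable setT (EFin \o (fun x => expR (- (x ^+ 2 / c)))).
Proof.
move=> c0.
have := integrableZl measurableT (Num.sqrt (c * pi))
  (integrable_normal_pdf 0 (Num.sqrt (c / 2))).
by apply: eq_integrable => // x _ /=; rewrite -EFinM gaussian_normal_pdf.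
Qed.

Lemma Rintegral_gaussian (c : R) : 0 < c ->
  \int[mu]_x expR (- (x ^+ 2 / c)) = Num.sqrt (c * pi).
Proof.
move=> c0.
under eq_Rintegral do rewrite (gaussian_normal_pdf c0).
rewrite RintegralZl //; last exact: integrable_normal_pdf.
by rewrite /Rintegral integral_normal_pdf mulr1.
Qed.

Definition gauss (x : R) : R := expR (- (x ^+ 2 / 2)).

Lemma is_derive_gauss (x : R) : is_derive x 1 gauss (- x * gauss x).
Proof.
rewrite /gauss; apply: is_derive_eq.
by rewrite /GRing.scale /= !mulr0 add0r; move: (expR _) => e; field.
Qed.

Lemma continuous_gauss : continuous gauss.
Proof.
move=> x; apply: differentiable_continuous; apply/derivable1_diffP.
exact: (@ex_derive _ _ _ _ _ _ _ (is_derive_gauss x)).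
Qed.

Lemma gauss_gt0 x : 0 < gauss x. Proof. exact: expR_gt0. Qed.

(** From [|x| <= 1 + x ^ 2 / 4 <= exp (x ^ 2 / 4)]. *)
Lemma norm_mul_gauss_le x : `|x| * gauss x <= expR (- (x ^+ 2 / 4)).
Proof.
have -> : gauss x = expR (- (x ^+ 2 / 4)) / expR (x ^+ 2 / 4).
  by rewrite -expRN -expRD; congr expR; field.
rewrite mulrCA ler_piMr ?expR_ge0 // ler_pdivrMr ?expR_gt0 // mul1r.
apply: le_trans (expR_ge1Dx _).
by rewrite -real_normK ?num_real //; have := sqr_ge0 (`|x| / 2 - 1); nra.
Qed.

Lemma integrable_gauss : mu.-integrable setT (EFin \o gauss).
Proof. exact: integrable_gaussian. Qed.

Lemma integrable_gauss_mul f : continuous f -> (forall x, `|f x| <= 1) ->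
  mu.-integrable setT (EFin \o (fun x => gauss x * f x)).
Proof.
move=> cf f1; apply: (continuous_integrable_dominated _ integrable_gauss).
  by move=> x; apply: cvgM; [exact: continuous_gauss|exact: cf].
by move=> x; rewrite normrM gtr0_norm ?gauss_gt0 // ler_piMr // ltW // gauss_gt0.
Qed.

Lemma integrable_mul_gauss_mul f : continuous f -> (forall x, `|f x| <= 1) ->
  mu.-integrable setT (EFin \o (fun x => x * gauss x * f x)).
Proof.
move=> cf f1.
apply: (@continuous_integrable_dominated _ (fun x => expR (- (x ^+ 2 / 4)))).
- move=> x; apply: cvgM; last exact: cf.
  by apply: cvgM; [exact: cvg_id|exact: continuous_gauss].
- exact: integrable_gaussian.
move=> x; apply: le_trans (norm_mul_gauss_le x).
by rewrite !normrM (gtr0_norm (gauss_gt0 x)) ler_piMr // mulr_ge0 // ltW // gauss_gt0.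
Qed.

Lemma continuous_cosZ (w : R) : continuous (fun u : R => cos (w * u)).
Proof.
move=> u; apply: continuous_comp; last exact: continuous_cos.
by apply: cvgM; [exact: cvg_cst|exact: cvg_id].
Qed.

Lemma continuous_sinZ (w : R) : continuous (fun u : R => sin (w * u)).
Proof.
move=> u; apply: continuous_comp; last exact: continuous_sin.
by apply: cvgM; [exact: cvg_cst|exact: cvg_id].
Qed.

(** The Fourier transform of [gauss]. *)
Definition gaussF (w : R) : R := \int[mu]_u (gauss u * cos (w * u)).

(** The difference of both integrands is the derivative of
    [gauss u * sin (w u)], which vanishes at infinity. *)
Lemma gauss_by_parts w :
  w * gaussF w = \int[mu]_u (u * gauss u * sin (w * u)).
Proof.
have ic := integrable_gauss_mul (@continuous_cosZ w) (fun u => cos_max (w * u)).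
have is_ := integrable_mul_gauss_mul (@continuous_sinZ w) (fun u => sin_max (w * u)).
have iwc : mu.-integrable setT (EFin \o (fun u => w * (gauss u * cos (w * u)))).
  by have := integrableZl measurableT w ic.
apply/eqP; rewrite -subr_eq0 /gaussF -RintegralZl // -RintegralB //.
set k := (fun u => w * (gauss u * cos (w * u)) - u * gauss u * sin (w * u)).
have ik : mu.-integrable setT (EFin \o k) by have := integrableB measurableT iwc is_.
have kl := cvg_Rintegral_itv ik.
pose h (u : R) := gauss u * sin (w * u).
have dh (u : R) : is_derive u 1 h (k u).
  have ds : is_derive u 1 (fun v : R => sin (w * v)) (cos (w * u) * w).
    by apply: is_derive_eq; rewrite /GRing.scale /=; ring.
  apply: is_derive_eq (is_deriveM (is_derive_gauss u) ds) _.
  by rewrite /k /GRing.scale /=; ring.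
have ck : continuous k.
  move=> u; apply: cvgB.
    apply: cvgM; first exact: cvg_cst.
    by apply: cvgM; [exact: continuous_gauss|exact: continuous_cosZ].
  apply: cvgM; last exact: continuous_sinZ.
  by apply: cvgM; [exact: cvg_id|exact: continuous_gauss].
have k0 : \int[mu]_(x in `[- n%:R, n%:R]) k x @[n --> \oo] --> (0 : R).
  have E : \forall n \near \oo, h n%:R - h (- n%:R) =
      \int[mu]_(x in `[- n%:R, n%:R]) k x.
    near=> n; rewrite (Rintegral_FTC2 _ ck dh) // gtrN //.
    by rewrite ltr0n; near: n; exact: nbhs_infty_gt.
  apply: cvg_trans (near_eq_cvg E) _.
  have inv0 : 2 * n%:R^-1 @[n --> \oo] --> (0 : R).
    rewrite -[X in _ --> X](mulr0 2); apply: cvgMr.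
    by rewrite -(cvg_shiftS (fun n => n%:R^-1 : R)); exact: cvg_harmonic.
  have inv0N : - (2 * n%:R^-1) @[n --> \oo] --> (0 : R).
    by have h2 := cvgN inv0; rewrite oppr0 in h2; exact: h2.
  apply: (squeeze_cvgr _ inv0N inv0).
  near=> n; rewrite -ler_norml.
  have n0 : 0 < n%:R :> R by rewrite ltr0n; near: n; exact: nbhs_infty_gt.
  have -> : h n%:R - h (- n%:R) = 2 * h n%:R.
    by rewrite /h /gauss sqrrN mulrN sinN; ring.
  rewrite normrM ger0_norm // ler_pM2l // /h normrM (gtr0_norm (gauss_gt0 _)).
  apply: (@le_trans _ _ (gauss n%:R)).
    by rewrite ler_piMr ?sin_max // ltW // gauss_gt0.
  rewrite -[leRHS]mul1r ler_pdivlMr // mulrC -[X in X * _](gtr0_norm n0).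
  apply: le_trans (norm_mul_gauss_le _) _.
  by rewrite -expR0 ler_expR oppr_le0 divr_ge0 // sqr_ge0.
by apply/eqP; exact: (cvg_unique _ kl k0).
Unshelve. all: by end_near. Qed.

End RealIntegrals.

(** * Fourier transform of the Gaussian *)

Section GaussFourier.
Context {R : realType}.
Local Notation mu := (@lebesgue_measure R).

(** Differentiation under the integral sign, dominated by
    [|u| gauss u <= exp (- u ^ 2 / 4)], followed by an integration by parts. *)
Lemma is_derive_gaussF (w : R) : is_derive w 1 gaussF (- w * gaussF w).
Proof.
pose f (x u : R) := gauss u * cos (x * u).
have df (x u : R) : is_derive x 1 (f ^~ u) (- (u * gauss u * sin (x * u))).
  have dc : is_derive x 1 (fun v : R => cos (v * u)) (- sin (x * u) * u).
    by apply: is_derive_eq; rewrite /GRing.scale /=; ring.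
  have dg : is_derive x 1 (cst (gauss u) : R -> R) 0 by exact: is_derive_cst.
  apply: is_derive_eq (is_deriveM dg dc) _.
  by rewrite /GRing.scale /=; ring.
pose G (u : R) := expR (- (u ^+ 2 / 4)).
have intf (x : R) : `]w - 1, w + 1[%classic x -> mu.-integrable setT (EFin \o f x).
  by move=> _; apply: integrable_gauss_mul; [exact: continuous_cosZ|move=> u; exact: cos_max].
have der (x u : R) : `]w - 1, w + 1[%classic x -> setT u -> derivable (f ^~ u) x 1.
  by move=> _ _; exact: (@ex_derive _ _ _ _ _ _ _ (df x u)).
have wI : `]w - 1, w + 1[%classic w by rewrite /= in_itv /=; lra.
have G0 u : 0 <= G u by exact: expR_ge0.
have iG : mu.-integrable setT (EFin \o G) by exact: integrable_gaussian.
have GE (x u : R) : partial1of2 f x u = - (u * gauss u * sin (x * u)).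
  by rewrite partial1of2E; exact: (@derive_val _ _ _ _ _ _ _ (df x u)).
have Gub (x u : R) : `]w - 1, w + 1[%classic x -> setT u -> `|partial1of2 f x u| <= G u.
  move=> _ _; rewrite GE normrN normrM; apply: le_trans (norm_mul_gauss_le u).
  by rewrite normrM (gtr0_norm (gauss_gt0 u)) ler_piMr ?sin_max // mulr_ge0 // ltW // gauss_gt0.
have D := @derivable_under_integral _ _ _ mu f setT measurableT w _ _
  wI intf der G G0 iG Gub.
have E := @differentiation_under_integral _ _ _ mu f setT measurableT w _ _
  wI intf der G G0 iG Gub.
apply: DeriveDef; first exact: D.
rewrite -derive1E; apply: etrans E _.
under eq_Rintegral do rewrite GE -mulN1r.
rewrite RintegralZl //; last first.
  by apply: integrable_mul_gauss_mul; [exact: continuous_sinZ|move=> u; exact: sin_max].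
by rewrite -gauss_by_parts; ring.
Qed.

(** [gaussF] and [gauss] satisfy the same linear differential equation. *)
Lemma gaussFE (w : R) : gaussF w = Num.sqrt (2 * pi) * gauss w.
Proof.
pose h (x : R) := gaussF x * expR (x ^+ 2 / 2).
have dh (x : R) : is_derive x 1 h 0.
  have de : is_derive x 1 (fun x : R => expR (x ^+ 2 / 2)) (x * expR (x ^+ 2 / 2)).
    apply: is_derive_eq; rewrite /GRing.scale /= !mulr0 add0r.
    by move: (expR _) => e; field.
  apply: is_derive_eq (is_deriveM (is_derive_gaussF x) de) _.
  by rewrite /GRing.scale /=; ring.
have := is_derive_0_is_cst w 0 dh; rewrite /h expr0n mul0r expR0 mulr1.
have -> : gaussF 0 = Num.sqrt (2 * pi) :> R.
  rewrite /gaussF -Rintegral_gaussian //.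
  by apply: eq_Rintegral => u _; rewrite mul0r cos0 mulr1.
by move=> <-; rewrite -mulrA /gauss -expRD subrr expR0 mulr1.
Qed.

End GaussFourier.

(** * Fourier inversion and a Gaussian bound *)

Section FourierInversion.
Variable R : realType.
Local Notation mu := (@lebesgue_measure R).
Local Notation a := (@pyrene_sextet R).

(** A crude form of Jordan's inequality: up to [1] by the mean value theorem and
    [cos 1 >= 1 / 2], beyond [1] by monotonicity and [pi / 2 < 2]. *)
Lemma sin_ge_quarter (s : R) : 0 <= s <= pi / 2 -> s / 4 <= sin s.
Proof.
have mvt (x : R) : 0 < x -> exists2 c, 0 < c < x & sin x = cos c * x.
  move=> x0; have [|c cx] := @MVT R sin cos 0 x x0 (fun y _ => is_derive_sin y).
    by apply: continuous_subspaceT; exact: continuous_sin.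
  by rewrite sin0 !subr0 => ->; exists c => //; move: cx; rewrite in_itv.
have p1 := @pihalf_ge1 R; have p2 := @pihalf_lt2 R.
have c1 : 2^-1 <= cos (1 : R).
  rewrite cos_half; have [c cx ->] := mvt (1 / 2) (divr_gt0 ltr01 (ltr0n R 2)).
  by have := cos_max c; rewrite -[X in X <= _]/(`|_|) ler_norml; nra.
have small (x : R) : 0 < x <= 1 -> x / 2 <= sin x.
  move=> /andP[x0 x1]; have [c /andP[c0 cx] ->] := mvt x x0.
  have : cos 1 <= cos c.
    by rewrite leNgt ltr_cos ?in_itv /=; [rewrite -leNgt; lra|lra|lra].
  nra.
move=> /andP[s0 sp]; have [->|s0'] := eqVneq s 0; first by rewrite sin0 mul0r.
have s1 : 0 < s by rewrite lt_neqAle eq_sym s0'.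
have [sl|sl] := leP s 1; first by have := small s; rewrite s1 sl => /(_ isT); lra.
have : sin 1 <= sin s by rewrite leNgt ltr_sin ?in_itv /=; [rewrite -leNgt; lra|lra|lra].
have := small 1; rewrite ltr01 lexx => /(_ isT); lra.
Qed.

Lemma cos_le_quadratic (t : R) : `|t| <= pi -> t ^+ 2 / 32 <= 1 - cos t.
Proof.
move=> tp; rewrite -cos_norm cos_half -real_normK ?num_real //.
move: (normr_ge0 t) tp; move: `|t| => s s0 sp.
have := @sin_ge_quarter (s / 2); rewrite ler_pM2r // sp divr_ge0 // => /(_ isT).
by move: (sin _) => z; nra.
Qed.

Lemma charf_ge0 n (t : R) : 0 <= charf n t.
Proof.
rewrite divr_ge0 // ltW // chebU_gt0 //; last by rewrite ler1n.
by have := cos_geN1 t; lra.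
Qed.

(** [charf n t <= ((2 + cos t) / 3) ^ n <= exp (- n (1 - cos t) / 3)], and
    [1 - cos t >= t ^ 2 / 32] on [[- pi, pi]]; the constant is [96 = 3 * 32]. *)
Lemma charf_bound n (u : R) : 0 < row_variance a n <= n%:R ->
  `|u| <= pi * row_sd a n -> charf n (u / row_sd a n) <= expR (- (u ^+ 2 / 96)).
Proof.
move=> /andP[v0 vn] us; have s0 : 0 < row_sd a n by rewrite sqrtr_gt0.
set t := u / row_sd a n.
have tp : `|t| <= pi by rewrite normrM normfV (gtr0_norm s0) ler_pdivrMr.
have y13 : 1 <= 2 + cos t <= 3 by have := cos_geN1 t; have := cos_le1 t; lra.
apply: le_trans (chebU_decay n y13) _.
have e1 : 0 <= (2 + cos t) / 3 <= expR (- ((1 - cos t) / 3)).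
  have := expR_ge1Dx (- ((1 - cos t) / 3)); lra.
have /andP[e2 e3] := e1.
apply: (@le_trans _ _ (expR (- ((1 - cos t) / 3)) ^+ n)).
  by rewrite lerXn2r // nnegrE // expR_ge0.
rewrite -expRM_natl ler_expR mulrN lerN2.
have ct := cos_le_quadratic tp.
have ut : u ^+ 2 = t ^+ 2 * row_variance a n.
  by rewrite -row_sd_sqr -exprMn /t divfK // gt_eqF.
rewrite ut; have := sqr_ge0 t; move: (t ^+ 2) ct => t2 ct t20.
have : t2 * row_variance a n <= t2 * n%:R by rewrite ler_wpM2l.
have : n%:R * (t2 / 32) <= n%:R * (1 - cos t) by rewrite ler_wpM2l.
lra.
Qed.

(** Conditions under which the scaling by [row_sd] is well defined and
    [charf_bound] applies. *)
Lemma row_variance_near : \forall n \near \oo, 0 < row_variance a n <= n%:R.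
Proof.
have s0 := sqrt2_gt0 R; have s2 := sqrt2_sqr R.
have s32 : Num.sqrt 2 < 2 :> R by nra.
near=> n.
have n1 : 0 < n%:R :> R by rewrite ltr0n; near: n; exact: nbhs_infty_gt.
have n1' : 1 <= n%:R :> R by rewrite ler1n; near: n; exact: nbhs_infty_ge.
have lb : 0 < row_variance a n / n.+1%:R.
  by near: n; apply: (cvgr_gt _ (@row_variance_limit R)); rewrite divr_gt0.
have ub : row_variance a n / n.+1%:R < 2^-1.
  by near: n; apply: (cvgr_lt _ (@row_variance_limit R)); lra.
have N0 : 0 < n.+1%:R :> R by rewrite ltr0n.
rewrite pmulr_lgt0 ?invr_gt0 // in lb; rewrite lb /=.
by move: ub; rewrite ltr_pdivrMr // -(@natr1 _ n); lra.
Unshelve. all: by end_near. Qed.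

Lemma size_sum_delta n (k : int) (c : R) :
  size_sum n (fun j => if j%:Z == k then c else 0) = c * a n k.
Proof.
rewrite /pyrene_sextet; case: ifP => [/andP[k0 kn]|kn].
  rewrite sextet_number_size_sum -size_sumZ; apply: eq_size_sum => j.
  have -> : (j%:Z == k) = (j == `|k|%N) by apply/eqP/eqP; lia.
  by case: eqP; rewrite ?mulr1 ?mulr0.
rewrite mulr0; apply: size_sum_eq0 => j jn; case: eqP => // jk.
by move: kn; rewrite -jk; lia.
Qed.

Lemma is_derive_size_sum n (h : nat -> R -> R) (dh : nat -> R) (u : R) :
  (forall j, is_derive u 1 (h j) (dh j)) ->
  is_derive u 1 (fun v => size_sum n (fun j => h j v)) (size_sum n dh).
Proof.
move=> hd; rewrite /size_sum /packing_sum; elim: (enum_fset _) => [|S r IH].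
  by rewrite big_nil; under eq_fun do rewrite big_nil; exact: is_derive_cst.
rewrite big_cons; under eq_fun do rewrite big_cons.
by case: ifP => _ //; exact: is_deriveD.
Qed.

Lemma sin_int_pi (l : int) : sin (l%:~R * pi) = 0 :> R.
Proof.
have nat_case (j : nat) : sin (j%:R * pi) = 0 :> R.
  by rewrite mulr_natl -[_ *+ j]add0r (alternatingn (@sinDpi R)) sin0 mulr0.
by case: l => j; [exact: nat_case|rewrite NegzE rmorphN /= mulNr sinN nat_case oppr0].
Qed.

(** Multiplying the characteristic function by [cos (m t)] gives a trigonometric
    sum with integer frequencies, and only the frequency zero contributes over a full
    period.  The sum is integrated through an explicit antiderivative, directly
    in the scaled variable [u = t * row_sd]. *)
Lemma fourier_inversion n (m : int) : 0 < row_sd a n ->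
  \int[mu]_(u in `[- (pi * row_sd a n), pi * row_sd a n])
     (charf n (u / row_sd a n) * cos (m%:~R / row_sd a n * u)) =
  2 * pi * (row_sd a n * row_prob a n (n%:Z + m)).
Proof.
set s := row_sd a n => s0; have sn0 : s != 0 by rewrite gt_eqF.
have p0 := @pi_gt0 R.
pose w (j : nat) : R := (j%:R - n%:R - m%:~R) / s.
pose F (u : R) := size_sum n (fun j => if j%:Z == n%:Z + m then u
  else (w j)^-1 * sin (w j * u)).
pose f (u : R) := size_sum n (fun j => cos (w j * u)).
have wE j : (w j == 0) = (j%:Z == n%:Z + m).
  rewrite mulf_eq0 invr_eq0 (negbTE sn0) orbF -addrA -opprD subr_eq0.
  by rewrite -(eqr_int R) rmorphD.
have fE u : f u = chebU n 3 * (charf n (u / s) * cos (m%:~R / s * u)).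
  rewrite /charf mulrA mulrCA mulfV ?mulr1 ?chebU3_neq0 //.
  rewrite -[in cos (m%:~R / s * u)]cosN -centered_sum_cos; apply: eq_size_sum => j.
  by congr cos; rewrite /w; field.
pose k (u : R) := charf n (u / s) * cos (m%:~R / s * u).
have U0 := chebU3_neq0 R n.
have dF (u : R) : is_derive u 1 (fun u => (chebU n 3)^-1 * F u) (k u).
  have dF : is_derive u 1 F (f u).
    apply: is_derive_size_sum => j; case: eqP => [/eqP|/eqP] jm.
      apply: is_derive_eq (is_derive_id u (1 : R)) _.
      by move: jm; rewrite -wE => /eqP->; rewrite mul0r cos0.
    rewrite -wE in jm.
    have dc : is_derive u 1 (cst (w j)^-1 : R -> R) 0 by exact: is_derive_cst.
    have ds : is_derive u 1 (fun v : R => sin (w j * v)) (cos (w j * u) * w j).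
      by apply: is_derive_eq; rewrite /GRing.scale /=; ring.
    apply: is_derive_eq (is_deriveM dc ds) _.
    by rewrite /GRing.scale /=; field.
  have dc : is_derive u 1 (cst (chebU n 3)^-1 : R -> R) 0 by exact: is_derive_cst.
  apply: is_derive_eq (is_deriveM dc dF) _.
  by rewrite fE /GRing.scale /= mulr0 addr0 mulKf.
have ck : continuous k.
  have -> : k = (fun u => (chebU n 3)^-1 * f u).
    by apply/funext => u; rewrite fE mulKf.
  move=> u; apply: cvgM; first exact: cvg_cst.
  have df : is_derive u 1 f (size_sum n (fun j => - sin (w j * u) * w j)).
    apply: is_derive_size_sum => j.
    by apply: is_derive_eq; rewrite /GRing.scale /=; ring.
  apply: differentiable_continuous; apply/derivable1_diffP.
  exact: (@ex_derive _ _ _ _ _ _ _ df).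
have pin : (- (pi * s)) < pi * s by rewrite gtrN // mulr_gt0.
rewrite (Rintegral_FTC2 pin ck dF) -mulrBr /row_prob pyrene_total.
suff -> : F (pi * s) - F (- (pi * s)) = 2 * pi * s * a n (n%:Z + m).
  by field.
rewrite -size_sum_delta /F /size_sum /packing_sum -sumrB; apply: eq_bigr => S _.
case: eqP => _; first by rewrite opprK; ring.
rewrite mulrN sinN (_ : w _ * (pi * s) = (#|` S|%fset%:Z - n%:Z - m)%:~R * pi).
  by rewrite sin_int_pi oppr0 mulr0 subr0.
by rewrite /w !rmorphB /=; field.
Qed.

End FourierInversion.

(** * The local limit theorem *)

Lemma ereal_sup_cvg0 (R : realType) (f : nat -> R -> R) (e : nat -> R) :
  (\forall n \near \oo, forall x, `|f n x| <= e n) -> e n @[n --> \oo] --> (0 : R) ->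
  (ereal_sup [set `|f n x|%:E | x in [set: R]] @[n --> \oo] --> 0%:E)%classic.
Proof.
move=> fe e0; have e0' : (e n)%:E @[n --> \oo] --> 0%:E.
  by apply/fine_cvgP; split; [exact: nearW|].
apply: (squeeze_cvge _ (cvg_cst 0%:E) e0'); near=> n; apply/andP; split.
  apply: (@le_trans _ _ `|f n 0|%:E); first by rewrite lee_fin.
  by apply: ereal_sup_ubound; exists 0.
apply: ge_ereal_sup => _ [x _ <-]; rewrite lee_fin.
by move: x; near: n.
Unshelve. all: by end_near. Qed.

Section LocalLimit.
Variable R : realType.
Local Notation mu := (@lebesgue_measure R).
Local Notation a := (@pyrene_sextet R).

Definition window n : set R := `[- (pi * row_sd a n), pi * row_sd a n]%classic.

(** The characteristic function in the scale of the standard deviation, cut off to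
    one period.  It is set to zero for the finitely many [n] to which the bound
    does not apply, so that one Gaussian dominates the whole sequence. *)
Definition scaled_charf n : R -> R :=
  if 0 < row_variance a n <= n%:R
  then (fun u => charf n (u / row_sd a n)) \_ (window n) else cst 0.

Lemma continuous_charf n : continuous (charf n : R -> R).
Proof.
move=> t; apply: cvgM; last exact: cvg_cst.
have cU : forall m, continuous (chebU m : R -> R).
  elim/nat_two_step_ind => [||m IH0 IH1] y.
  - exact: cvg_cst.
  - by apply: cvgM; [exact: cvg_cst|exact: cvg_id].
  - apply: cvgB; last exact: IH0.
    by apply: cvgM; [apply: cvgM; [exact: cvg_cst|exact: cvg_id]|exact: IH1].
apply: (@continuous_comp _ _ _ (fun t : R => 2 + cos t) (chebU n)); last exact: cU.
by apply: cvgD; [exact: cvg_cst|exact: continuous_cos].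
Qed.

Lemma measurable_scaled_charf n : measurable_fun setT (scaled_charf n).
Proof.
rewrite /scaled_charf; case: ifP => _; last exact: measurable_cst.
rewrite /window; apply/(measurable_restrictT _ _).1 => //; apply: measurable_funTS.
apply: continuous_measurable_fun => u.
apply: (@continuous_comp _ _ _ (fun u : R => u / row_sd a n) (charf n)).
  by apply: cvgM; [exact: cvg_id|exact: cvg_cst].
exact: continuous_charf.
Qed.

Lemma scaled_charf_bound n u : `|scaled_charf n u| <= expR (- (u ^+ 2 / 96)).
Proof.
rewrite /scaled_charf; case: ifP => v; last by rewrite normr0 expR_ge0.
rewrite patchE; case: ifP => [/set_mem|_]; last by rewrite normr0 expR_ge0.
rewrite /window /= in_itv /= -ler_norml => us.
by rewrite ger0_norm ?charf_ge0 // charf_bound.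
Qed.

Lemma scaled_charf_limit u : scaled_charf n u @[n --> \oo] --> gauss u.
Proof.
have h := @charf_limit _ u; rewrite -/(gauss u) in h.
apply: cvg_trans h; apply: near_eq_cvg; near=> n.
have v : 0 < row_variance a n <= n%:R by near: n; exact: row_variance_near.
have s0 : 0 < row_sd a n by rewrite sqrtr_gt0; case/andP: v.
rewrite /scaled_charf v patchE ifT //; apply/mem_set.
rewrite /window /= in_itv /= -ler_norml -ler_pdivrMr //.
near: n; apply: (cvgr_le 0); last exact: pi_gt0.
rewrite -[X in _ --> X](mulr0 `|u|); apply: cvgMr; exact: row_sd_inv_limit.
Unshelve. all: by end_near. Qed.

(** The L1 distance between characteristic functions, which bounds the uniform distance
    between densities. *)
Definition charf_error n : R := \int[mu]_u `|scaled_charf n u - gauss u|.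

Lemma charf_error_limit : charf_error n @[n --> \oo] --> (0 : R).
Proof.
have ig : mu.-integrable setT (EFin \o (fun u : R => expR (- (u ^+ 2 / 96)))).
  exact: integrable_gaussian.
by have [] := dominated_cvg_R measurable_scaled_charf ig scaled_charf_bound scaled_charf_limit.
Qed.

Lemma inv_sqrt2pi_le1 : 0 < (Num.sqrt (2 * (pi : R)))^-1 <= 1.
Proof.
have p2 := @pi_ge2 R; have s1 : 1 <= Num.sqrt (2 * pi) :> R.
  by rewrite -[leLHS]sqrtr1 ler_sqrt; lra.
by rewrite invr_gt0 invf_le1 // (lt_le_trans ltr01 s1) // s1.
Qed.

(** Both terms are Fourier integrals, over the period and over the line, of
    functions whose L1 distance is [charf_error n]. *)
Lemma row_prob_gauss n (m : int) : 0 < row_variance a n <= n%:R ->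
  `|row_sd a n * row_prob a n (n%:Z + m)
     - (Num.sqrt (2 * pi))^-1 * gauss (m%:~R / row_sd a n)| <= charf_error n.
Proof.
move=> v; have s0 : 0 < row_sd a n by rewrite sqrtr_gt0; case/andP: v.
have p2 := @pi_ge2 R; have q0 : 0 < Num.sqrt (2 * pi) :> R.
  by rewrite sqrtr_gt0 mulr_gt0 // pi_gt0.
set w := m%:~R / row_sd a n.
have ig : mu.-integrable setT (EFin \o (fun u : R => expR (- (u ^+ 2 / 96)))).
  exact: integrable_gaussian.
have isc : mu.-integrable setT (EFin \o (fun u => scaled_charf n u * cos (w * u))).
  apply: (dominated_integrable_R _ ig).
    apply: measurable_funM; first exact: measurable_scaled_charf.
    by apply: continuous_measurable_fun; exact: continuous_cosZ.
  move=> u; rewrite normrM; apply: le_trans (scaled_charf_bound n u).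
  by rewrite ler_piMr // cos_max.
have igc : mu.-integrable setT (EFin \o (fun u => gauss u * cos (w * u))).
  by apply: integrable_gauss_mul; [exact: continuous_cosZ|move=> u; exact: cos_max].
have ie : mu.-integrable setT (EFin \o (fun u => scaled_charf n u - gauss u)).
  have isch := dominated_integrable_R (measurable_scaled_charf n) ig (scaled_charf_bound n).
  by have := integrableB measurableT isch (@integrable_gauss R).
have E : \int[mu]_u (scaled_charf n u * cos (w * u)) =
    2 * pi * (row_sd a n * row_prob a n (n%:Z + m)).
  rewrite -fourier_inversion // [RHS]Rintegral_mkcond; apply: eq_Rintegral => u _.
  by rewrite /scaled_charf v !patchE; case: ifP => _ //; rewrite mul0r.
have -> : row_sd a n * row_prob a n (n%:Z + m) - (Num.sqrt (2 * pi))^-1 * gauss w =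
    (2 * pi)^-1 * \int[mu]_u (scaled_charf n u * cos (w * u) - gauss u * cos (w * u)).
  rewrite RintegralB // E -/(gaussF w) gaussFE mulrBr mulKf; last first.
    by rewrite gt_eqF // mulr_gt0 // pi_gt0.
  congr (_ - _); rewrite mulrA; congr (_ * _).
  rewrite -[in (2 * pi)^-1](@sqr_sqrtr _ (2 * pi)) ?mulr_ge0 // ?pi_ge0 //.
  by field; rewrite gt_eqF.
rewrite normrM ger0_norm; last by rewrite invr_ge0 mulr_ge0 // pi_ge0.
apply: (@le_trans _ _ `|\int[mu]_u (scaled_charf n u * cos (w * u) - gauss u * cos (w * u))|).
  by rewrite ler_piMl // invf_le1; [lra|rewrite mulr_gt0 // pi_gt0].
apply: le_trans.
  by apply: le_normr_Rintegral => //; have := integrableB measurableT isc igc.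
apply: le_Rintegral => //.
- by have := integrable_norm (integrableB measurableT isc igc).
- by have := integrable_norm ie.
by move=> u _; rewrite -mulrBl normrM ler_piMr // cos_max.
Qed.

Lemma gauss_lipschitz (x y : R) : `|gauss x - gauss y| <= `|x - y|.
Proof.
wlog xy : x y / x < y.
  move=> W; have [xy|xy|->] := ltgtP x y; first exact: W.
    by rewrite distrC [leRHS]distrC; exact: W.
  by rewrite !subrr.
rewrite distrC [leRHS]distrC.
have [|c _ ->] := @MVT R gauss (fun c => - c * gauss c) x y xy (fun c _ => is_derive_gauss c).
  by apply: continuous_subspaceT; exact: continuous_gauss.
rewrite normrM ler_piMl // normrM normrN (gtr0_norm (gauss_gt0 c)).
apply: le_trans (norm_mul_gauss_le c) _.
by rewrite -expR0 ler_expR oppr_le0 divr_ge0 // sqr_ge0.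
Qed.

(** Replacing [x] by the lattice point below it moves the argument of the Gaussian
    by at most [1 / row_sd], and the Gaussian is Lipschitz. *)
Lemma local_limit_error : \forall n \near \oo, forall x : R,
  `|row_sd a n * row_prob a n (Num.floor (row_mean a n + x * row_sd a n))
    - (Num.sqrt (2 * pi))^-1 * gauss x| <= charf_error n + (row_sd a n)^-1.
Proof.
near=> n => x.
have v : 0 < row_variance a n <= n%:R by near: n; exact: row_variance_near.
have s0 : 0 < row_sd a n by rewrite sqrtr_gt0; case/andP: v.
rewrite pyrene_mean; set k := Num.floor _.
have /andP[k1 k2] : k%:~R <= n%:R + x * row_sd a n < (k + 1)%:~R by exact: floor_itv.
have -> : k = n%:Z + (k - n%:Z) by ring.
set m := k - n%:Z; have mE : m%:~R = k%:~R - n%:R :> R by rewrite rmorphB.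
have mx : `|m%:~R / row_sd a n - x| <= (row_sd a n)^-1.
  rewrite -[X in _ - X](mulfK (lt0r_neq0 s0)) -mulrBl normrM normfV (gtr0_norm s0).
  rewrite ler_piMl ?invr_ge0 ?(ltW s0) // ler_norml mE.
  by move: k2; rewrite rmorphD /=; lra.
have /andP[q0 q1] := inv_sqrt2pi_le1.
apply: (le_trans (ler_distD ((Num.sqrt (2 * pi))^-1 * gauss (m%:~R / row_sd a n)) _ _)).
apply: lerD; first exact: row_prob_gauss.
rewrite -mulrBr normrM (gtr0_norm q0) -[leRHS]mul1r ler_pM ?(ltW q0) //.
exact: le_trans (gauss_lipschitz _ _) mx.
Unshelve. all: by end_near. Qed.

Lemma local_error_limit : charf_error n + (row_sd a n)^-1 @[n --> \oo] --> (0 : R).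
Proof.
by rewrite -[X in _ --> X]addr0; apply: cvgD; [exact: charf_error_limit|exact: row_sd_inv_limit].
Qed.

Lemma pyrene_local_limit : local_limit_normal a.
Proof.
apply: (@ereal_sup_cvg0 _ (fun n x => _) _ local_limit_error local_error_limit).
Qed.

End LocalLimit.

(** * Step densities and the central limit theorem *)

Section StepFunctions.
Context {R : realType}.
Local Notation mu := (@lebesgue_measure R).

(** The set of [x] with [floor (n + x s) = k]; see [step_itvE]. *)
Definition step_itv (s : R) (n : nat) (k : int) : set R :=
  `[(k%:~R - n%:R) / s, ((k + 1)%:~R - n%:R) / s[%classic.

Lemma step_itvE (s : R) n k x : 0 < s ->
  step_itv s n k x <-> Num.floor (n%:R + x * s) = k.
Proof.
move=> s0; rewrite /step_itv /= in_itv /= ler_pdivrMr // ltr_pdivlMr //.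
split=> [h|<-]; first by apply: floor_def; lra.
by have := floor_itv (n%:R + x * s); lra.
Qed.

Lemma measurable_step_itv (s : R) n k : measurable (step_itv s n k).
Proof. exact: measurable_itv. Qed.

Lemma integrable_step (s : R) n k (c : R) :
  mu.-integrable setT (EFin \o (fun x => c * \1_(step_itv s n k) x)).
Proof.
by have := integrableZl measurableT c (integrable_indic_itv ((k%:~R - n%:R) / s)
  (((k + 1)%:~R - n%:R) / s) true true).
Qed.

Lemma Rintegral_steps (s : R) n N (c : nat -> R) (D : set R) : measurable D ->
  mu.-integrable setT (EFin \o (fun x => \sum_(0 <= k < N) c k * \1_(step_itv s n k%:Z) x)) /\
  \int[mu]_(x in D) (\sum_(0 <= k < N) c k * \1_(step_itv s n k%:Z) x) =
  \sum_(0 <= k < N) c k * fine (mu (step_itv s n k%:Z `&` D)).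
Proof.
move=> mD; elim: N => [|N [iN IH]].
  rewrite big_nil; split.
    under eq_fun do rewrite big_nil; exact: integrable0.
  under eq_Rintegral do rewrite big_nil.
  by rewrite Rintegral_cst // mul0r.
have E : (fun x => \sum_(0 <= k < N.+1) c k * \1_(step_itv s n k%:Z) x) =
  (fun x => \sum_(0 <= k < N) c k * \1_(step_itv s n k%:Z) x + c N * \1_(step_itv s n N%:Z) x).
  by apply/funext => x; rewrite big_nat_recr.
rewrite E big_nat_recr //=; split.
  by have := integrableD measurableT iN (integrable_step s n N%:Z (c N)).
have sub := @integrableS _ _ _ mu setT D _ measurableT mD (@subsetT _ D).
rewrite RintegralD //; [|exact: sub iN|exact: sub (integrable_step _ _ _ _)].
rewrite IH; congr (_ + _); rewrite RintegralZl //; last first.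
  have := sub _ (integrable_step s n N%:Z 1).
  by apply: eq_integrable => // x _ /=; rewrite mul1r.
by rewrite /Rintegral integral_indic //; exact: measurable_step_itv.
Qed.

Lemma step_itv_measure (s : R) n k : 0 < s -> fine (mu (step_itv s n k)) = s^-1.
Proof.
move=> s0; rewrite lebesgue_measure_itv /= lte_fin ltr_pM2r ?invr_gt0 //.
rewrite ltrD2r ltr_int ltrDl ltr01 /= rmorphD /=.
by rewrite -mulrBl -[RHS]mul1r; congr (_ * _); ring.
Qed.

End StepFunctions.

Section CentralLimit.
Variable R : realType.
Local Notation mu := (@lebesgue_measure R).
Local Notation a := (@pyrene_sextet R).
Local Notation sd := (row_sd a).

Definition normal_density (x : R) : R := (Num.sqrt (2 * pi))^-1 * gauss x.

Lemma integrable_normal_density : mu.-integrable setT (EFin \o normal_density).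
Proof.
by have := integrableZl measurableT (Num.sqrt (2 * pi))^-1 (@integrable_gauss R).
Qed.

Lemma normal_density_ge0 x : 0 <= normal_density x.
Proof. by rewrite mulr_ge0 ?ltW ?gauss_gt0 //; have /andP[] := @inv_sqrt2pi_le1 R. Qed.

Lemma normal_density_le1 x : normal_density x <= 1.
Proof.
have /andP[c0 c1] := @inv_sqrt2pi_le1 R.
rewrite -[leRHS]mul1r ler_pM ?(ltW c0) ?(ltW (gauss_gt0 _)) //.
by rewrite -expR0 ler_expR oppr_le0 divr_ge0 // sqr_ge0.
Qed.

Lemma Rintegral_normal_density : \int[mu]_x normal_density x = 1.
Proof.
rewrite RintegralZl //; last exact: integrable_gauss.
by rewrite Rintegral_gaussian // mulVf // gt_eqF // sqrtr_gt0 mulr_gt0 // pi_gt0.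
Qed.

Lemma row_prob_ge0 n k : 0 <= row_prob a n k.
Proof.
rewrite /row_prob pyrene_total divr_ge0 ?(ltW (chebU_gt0 _ _)) ?ler1n //.
by rewrite /pyrene_sextet; case: ifP.
Qed.

Lemma row_prob_eq0 n k : ~~ (0 <= k <= (2 * n)%:Z) -> row_prob a n k = 0.
Proof. by move=> kn; rewrite /row_prob /pyrene_sextet (negbTE kn) mul0r. Qed.

Lemma row_prob_total n : \sum_(0 <= k < (2 * n).+1) row_prob a n k%:Z = 1.
Proof.
rewrite -(fsum_int_support (@row_prob_eq0 n)).
under eq_fsbigr do rewrite -[row_prob _ _ _]mul1r.
rewrite row_prob_fsum -[size_sum _ _]/(centered_sum n (fun=> 1)).
by rewrite centered_sum_const divff // chebU3_neq0.
Qed.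

(** The distribution smeared out to a density: constant on the intervals of
    length [1 / row_sd] that the rounding sends to the same lattice point. *)
Definition step_density n (x : R) : R :=
  \sum_(0 <= k < (2 * n).+1) (sd n * row_prob a n k%:Z) * \1_(step_itv (sd n) n k%:Z) x.

Lemma step_densityE n x : 0 < sd n ->
  step_density n x = sd n * row_prob a n (Num.floor (n%:R + x * sd n)).
Proof.
move=> s0; rewrite /step_density; set K := Num.floor _.
have iE k : \1_(step_itv (sd n) n k) x = (K == k)%:R :> R.
  rewrite indicE; congr (nat_of_bool _)%:R; apply/idP/eqP => [/set_mem|].
    by move=> /(step_itvE _ _ _ s0).
  by move=> Kk; apply/mem_set/(step_itvE _ _ _ s0).
under eq_bigr do rewrite iE.
have [Kn|Kn] := boolP (0 <= K <= (2 * n)%:Z); last first.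
  rewrite row_prob_eq0 // mulr0 big_nat big1 // => k kn.
  by case: eqP => [Kk|]; rewrite ?mulr0 //; move: Kn; rewrite Kk; lia.
rewrite (bigD1_seq `|K|%N) ?iota_uniq ?mem_index_iota //=; last by lia.
have -> : `|K|%N%:Z = K by lia.
rewrite eqxx mulr1 big1 ?addr0 // => k kK.
by case: eqP => [Kk|]; rewrite ?mulr0 //; move: kK; rewrite Kk; lia.
Qed.

Lemma step_density_ge0 n x : 0 <= step_density n x.
Proof. by apply: sumr_ge0 => k _; rewrite mulr_ge0 // mulr_ge0 ?sqrtr_ge0 ?row_prob_ge0. Qed.

Lemma integrable_step_density n : mu.-integrable setT (EFin \o step_density n).
Proof.
by have [] := Rintegral_steps (sd n) n (2 * n).+1
  (fun k => sd n * row_prob a n k%:Z) measurableT.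
Qed.

Lemma Rintegral_step_density n : 0 < sd n -> \int[mu]_x step_density n x = 1.
Proof.
move=> s0.
have [_ ->] := Rintegral_steps (sd n) n (2 * n).+1
  (fun k => sd n * row_prob a n k%:Z) measurableT.
rewrite -(row_prob_total n); apply: eq_bigr => k _.
by rewrite setIT step_itv_measure // mulrC mulKf // gt_eqF.
Qed.

Lemma step_density_near : \forall n \near \oo, forall x : R,
  `|step_density n x - normal_density x| <= charf_error R n + (sd n)^-1.
Proof.
near=> n => x.
have v : 0 < row_variance a n <= n%:R by near: n; exact: row_variance_near.
have s0 : 0 < sd n by rewrite sqrtr_gt0; case/andP: v.
rewrite step_densityE // -pyrene_mean; move: x; near: n; exact: local_limit_error.
Unshelve. all: by end_near. Qed.

Definition density_error n : R := \int[mu]_x `|step_density n x - normal_density x|.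

(** Scheffe's argument: two probability densities [f] and [g] have
    [|f - g| = (f - g) + 2 (g - f)^+], and [(g - f)^+] is dominated by [g]; so the
    pointwise convergence of the local limit theorem gives convergence in L1. *)
Lemma density_error_limit : density_error n @[n --> \oo] --> (0 : R).
Proof.
pose h n x := Num.max (normal_density x - step_density n x) 0.
have mdens : measurable_fun setT normal_density.
  by apply/measurable_EFinP; apply: measurable_int integrable_normal_density.
have mstep n : measurable_fun setT (step_density n).
  by apply/measurable_EFinP; apply: measurable_int (integrable_step_density n).
have mh n : measurable_fun setT (h n).
  by apply: measurable_maxr; [exact: measurable_funB|exact: measurable_cst].
have hg n x : `|h n x| <= normal_density x.
  rewrite ger0_norm ?le_max ?lexx ?orbT // ge_max normal_density_ge0 andbT.
  by rewrite gerBl step_density_ge0.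
have h0 x : h n x @[n --> \oo] --> (0 : R).
  have e0 := @local_error_limit R.
  apply: (squeeze_cvgr _ (cvg_cst 0) e0); near=> n.
  have err : `|step_density n x - normal_density x| <= charf_error R n + (sd n)^-1.
    by near: n; apply: filterS step_density_near => n; apply.
  apply/andP; split; first by rewrite le_max lexx orbT.
  rewrite ge_max (le_trans (normr_ge0 _) err) andbT.
  by apply: le_trans err; rewrite distrC ler_norm.
have [_ + _] := dominated_cvg_R mh integrable_normal_density hg h0.
have -> : (fun n => \int[mu]_x `|h n x - 0|) = (fun n => \int[mu]_x h n x).
  apply/funext => n; apply: eq_Rintegral => x _.
  by rewrite subr0 ger0_norm // le_max lexx orbT.
move=> hi; have {}hi : 2 * \int[mu]_x h n x @[n --> \oo] --> (0 : R).
  by rewrite -[X in _ --> X](mulr0 2); apply: cvgMr.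
apply: cvg_trans hi; apply: near_eq_cvg; near=> n.
have v : 0 < row_variance a n <= n%:R by near: n; exact: row_variance_near.
have s0 : 0 < sd n by rewrite sqrtr_gt0; case/andP: v.
have ih : mu.-integrable setT (EFin \o h n).
  exact: (dominated_integrable_R (mh n) integrable_normal_density (hg n)).
have id : mu.-integrable setT (EFin \o (fun x => step_density n x - normal_density x)).
  by have := integrableB measurableT (integrable_step_density n) integrable_normal_density.
have i2h : mu.-integrable setT (EFin \o (fun x => 2 * h n x)).
  by have := integrableZl measurableT 2 ih.
have -> : density_error n =
    \int[mu]_x ((step_density n x - normal_density x) + 2 * h n x).
  apply: eq_Rintegral => x _; rewrite /h.
  have [l|l] := leP (normal_density x - step_density n x) 0.
    by rewrite mulr0 addr0 ger0_norm //; lra.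
  by rewrite ltr0_norm; lra.
rewrite RintegralD // RintegralB //; [|exact: integrable_step_density|exact: integrable_normal_density].
rewrite Rintegral_step_density // Rintegral_normal_density subrr add0r RintegralZl //.
Unshelve. all: by end_near. Qed.

Lemma central_sumE n (y : R) :
  \sum_(k \in [set k : int | k%:~R <= y]) row_prob a n k =
  \sum_(0 <= k < (2 * n).+1) (if k%:Z <= Num.floor y then row_prob a n k%:Z else 0).
Proof.
rewrite fsbig_mkcond (@fsum_int_support _ _ (2 * n)); last first.
  by move=> k kn; rewrite patchE row_prob_eq0 // if_same.
apply: eq_bigr => k _; rewrite patchE floor_ge_int.
by congr (if _ then _ else _); apply/idP/idP => [/set_mem|/mem_set].
Qed.

(** The interval ends just where the step of index [K] does, so the integral of
    the step density is exactly a partial sum of probabilities. *)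
Lemma Rintegral_step_density_Ny n (K : int) : 0 < sd n ->
  \int[mu]_(x in `]-oo, ((K + 1)%:~R - n%:R) / sd n]) step_density n x =
  \sum_(0 <= k < (2 * n).+1) (if k%:Z <= K then row_prob a n k%:Z else 0).
Proof.
move=> s0; set y := _ / _; rewrite -Rintegral_itv_bndo_bndc; last first.
  by apply: integrableS (integrable_step_density n).
have mD : measurable (`]-oo, y[%classic : set R) by exact: measurable_itv.
have [_ ->] := Rintegral_steps (sd n) n (2 * n).+1 (fun k => sd n * row_prob a n k%:Z) mD.
apply: eq_bigr => k _; case: ifP => kK.
  rewrite setIidl ?step_itv_measure //; first by rewrite mulrC mulKf // gt_eqF.
  move=> x; rewrite /step_itv /= !in_itv /= => /andP[_ xk]; apply: lt_le_trans xk _.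
  by rewrite ler_pM2r ?invr_gt0 // lerD2r ler_int lerD2r.
rewrite (_ : _ `&` _ = set0) ?measure0 ?mulr0 //; apply/seteqP; split=> x //=.
rewrite /step_itv /= !in_itv /= => -[/andP[kx _] xy].
have := le_lt_trans kx xy; rewrite /y ltr_pM2r ?invr_gt0 // ltrD2r ltr_int; lia.
Qed.

(** Moving the upper limit [x] to the end of its step changes the normal
    distribution function by at most [1 / row_sd]. *)
Lemma central_limit_error : \forall n \near \oo, forall x : R,
  `|\sum_(k \in [set k : int | k%:~R <= row_mean a n + x * sd n]) row_prob a n k
    - (Num.sqrt (2 * pi))^-1 *
      \int[mu]_(t in `]-oo, x]) expR (- (t ^+ 2 / 2))| <= density_error n + (sd n)^-1.
Proof.
near=> n => x.
have v : 0 < row_variance a n <= n%:R by near: n; exact: row_variance_near.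
have s0 : 0 < sd n by rewrite sqrtr_gt0; case/andP: v.
rewrite pyrene_mean central_sumE; set K := Num.floor _.
rewrite -(Rintegral_step_density_Ny K s0); set y := _ / _.
have /andP[k1 k2] : K%:~R <= n%:R + x * sd n < (K + 1)%:~R by exact: floor_itv.
have xy : x <= y by rewrite ler_pdivlMr //; lra.
have yx : y - x <= (sd n)^-1.
  rewrite -[X in _ - X](mulfK (lt0r_neq0 s0)) -mulrBl -[leRHS]mul1r.
  by rewrite ler_pM2r ?invr_gt0 // rmorphD /=; lra.
have sub (i : interval R) f : mu.-integrable setT f -> mu.-integrable [set` i] f.
  by apply: integrableS => //; exact: measurable_itv.
have id : mu.-integrable setT (EFin \o (fun x => step_density n x - normal_density x)).
  by have := integrableB measurableT (integrable_step_density n) integrable_normal_density.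
rewrite -RintegralZl //; last by apply: sub; exact: integrable_gauss.
rewrite -/(\int[mu]_(t in `]-oo, x]) normal_density t).
apply: (le_trans (ler_distD (\int[mu]_(t in `]-oo, y]) normal_density t) _ _)).
apply: lerD.
  rewrite -RintegralB //; [|by apply: sub; exact: integrable_step_density
                           |by apply: sub; exact: integrable_normal_density].
  apply: le_trans; first by apply: le_normr_Rintegral => //; exact: sub id.
  rewrite /density_error Rintegral_mkcond; apply: le_Rintegral => //.
  - rewrite -restrict_EFin; apply/(@integrable_mkcond _ _ _ mu `]-oo, y]) => //.
    exact: (sub _ _ (integrable_norm id)).
  - by have := integrable_norm id.
  - by move=> t _; rewrite patchE; case: ifP => _ //; exact: normr_ge0.
rewrite Rintegral_itvB //; last by apply: sub; exact: integrable_normal_density.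
rewrite ger0_norm; last by apply: Rintegral_ge0 => t _; exact: normal_density_ge0.
apply: le_trans yx; apply: (@le_trans _ _ (\int[mu]_(t in `]x, y]) 1)).
  apply: le_Rintegral => //.
  - by apply: sub; exact: integrable_normal_density.
  - apply: (@integrableS _ _ _ mu `[x, y]) => //; first exact: subset_itv_oc_cc.
    apply: continuous_compact_integrable; first exact: segment_compact.
    by apply: continuous_subspaceT => t; exact: cst_continuous.
  - by move=> t _; exact: normal_density_le1.
rewrite Rintegral_cst // mul1r.
apply: (@le_trans _ _ (fine (lebesgue_measure (`]x, y]%classic : set R)))); first exact: lexx.
rewrite lebesgue_measure_itv /= lte_fin.
by case: ifP => _ //=; rewrite subr_ge0.
Unshelve. all: by end_near. Qed.

Lemma pyrene_central_limit : central_limit_normal a.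
Proof.
apply: (@ereal_sup_cvg0 _ (fun n x => _) _ central_limit_error).
by rewrite -[X in _ --> X]addr0; apply: cvgD; [exact: density_error_limit|exact: row_sd_inv_limit].
Qed.

End CentralLimit.

(** * Asymptotic normality of the sextet numbers *)

Lemma pyrene_variance_equiv (R : realType) :
  (row_variance (@pyrene_sextet R) : nat -> R) ~_\oo
    (fun n : nat => Num.sqrt 2 / 4 * n%:R : R).
Proof.
set v := row_variance _; set c := Num.sqrt 2 / 4.
have c0 : 0 < c by rewrite divr_gt0 // sqrt2_gt0.
apply/eqaddoP => e e0.
have d0 : v n / n.+1%:R - c + c * harmonic n @[n --> \oo] --> (0 : R).
  have -> : 0 = c - c + c * 0 :> R by ring.
  apply: cvgD; last by apply: cvgMr; exact: cvg_harmonic.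
  by apply: cvgB; [exact: row_variance_limit|exact: cvg_cst].
near=> n.
have n1 : 1 <= n%:R :> R by rewrite ler1n; near: n; exact: nbhs_infty_ge.
have nE : n.+1%:R = n%:R + 1 :> R by rewrite natr1.
have N0 : 0 < n.+1%:R :> R by rewrite ltr0n.
(* [v n - c n = (n + 1) (v n / (n + 1) - c) + c], and [(n + 1) / 2 <= n] *)
have -> : (v - (fun n => c * n%:R)) n = n.+1%:R * (v n / n.+1%:R - c + c * harmonic n).
  by rewrite !fctE /harmonic /= nE; field; rewrite -nE gt_eqF.
rewrite normrM (gtr0_norm N0) (ger0_norm (_ : 0 <= c * n%:R)) ?mulr_ge0 ?(ltW c0) //.
have : `|v n / n.+1%:R - c + c * harmonic n| <= e * c / 2.
  near: n; apply: (cvgr0_norm_le _ d0); by rewrite divr_gt0 // mulr_gt0.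
have := mulr_gt0 e0 c0; rewrite nE [e * (c * _)]mulrA.
set z := `|_|; move: z (e * c) => {}z ec ec0 zle.
move: (n%:R : R) n1 => N n1.
apply: (@le_trans _ _ ((N + 1) * (ec / 2))); first by rewrite ler_wpM2l //; lra.
have : 0 <= (N - 1) * ec by rewrite mulr_ge0 ?(ltW ec0) // subr_ge0.
by nra.
Unshelve. all: by end_near. Qed.

Theorem theorem2p10 (R : realType) :
  (forall n : nat,
     sextet_poly (pyrene_chain n) =
     \sum_(k < (2 * n).+1) (sextet_number (pyrene_chain n) k)%:R *: 'X^k) /\
  central_limit_normal (@pyrene_sextet R) /\
  local_limit_normal (@pyrene_sextet R) /\
  (forall n : nat, row_mean (@pyrene_sextet R) n = n%:R) /\
  (row_variance (@pyrene_sextet R) : nat -> R) ~_\oo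
    (fun n : nat => Num.sqrt 2 / 4 * n%:R : R).
Proof.
split; first exact: sextet_poly_pyrene.
split; first exact: pyrene_central_limit.
split; first exact: pyrene_local_limit.
split; first exact: pyrene_mean.
exact: pyrene_variance_equiv.
Qed.
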